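(* Let $q>0$, and let $\mathcal{T}$ be the family of (edge sets of) spanning trees of the complete graph $K_n$. Equip the edges of $K_n$ with i.i.d. weights $X_e$, each distributed as $U^{1/q}$ where $U\sim U(0,1)$, and let $M(\mathcal{T})=\min_{T\in\mathcal{T}}\sum_{e\in T}X_e$. Then there exists a constant $c_q$ such that, with $L:=c_q n^{1-1/q}$, \[ \frac{|M(\mathcal{T})-L|}{L}=O_{\mathbb{P}}\!\left(n^{-\frac{q}{2(q+1)}}\right)=o_{\mathbb{P}}(1)\quad\text{as } n\to\infty. \]
   Context: For sequences of random variables $X_n,Y_n$: $X_n=o_{\mathbb{P}}(Y_n)$ means $X_n/Y_n\to 0$ in probability; $X_n=O_{\mathbb{P}}(Y_n)$ means that for every $\varepsilon>0$ there is a constant $C>0$ such that $X_n\le CY_n$ with probability at least $1-\varepsilon$ for all sufficiently large $n$. *)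

(* Defs.v *)
From HB Require Import structures.
From mathcomp Require Import all_boot all_order all_algebra.
From mathcomp Require Import all_classical all_reals all_analysis.

Set Implicit Arguments.
Unset Strict Implicit.
Unset Printing Implicit Defensive.

Import Order.TTheory GRing.Theory Num.Theory.
Import numFieldNormedType.Exports.

Local Open Scope classical_set_scope.
Local Open Scope ring_scope.

(* The edges of the complete graph on the vertex set 'I_n. *)
Definition edge (n : nat) := {e : {set 'I_n} | (#|e| == 2)%N}.

Definition adj (n : nat) (T : {set edge n}) : rel 'I_n :=
  fun u v => [exists e in T, val e == [set u; v]%SET].

Definition connected_graph (n : nat) (T : {set edge n}) : Prop :=
  forall u v : 'I_n, connect (adj T) u v.

(* [size c >= 3] rules out [:: u; v] with u and v adjacent, which [ucycle]
   accepts although it goes back and forth along a single edge. *)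
Definition acyclic (n : nat) (T : {set edge n}) : Prop :=
  forall c : seq 'I_n, (3 <= size c)%N -> ~ ucycle (adj T) c.

Definition spanning_tree (n : nat) (T : {set edge n}) : Prop :=
  [/\ (0 < n)%N, connected_graph T & acyclic T].

(* The infimum is over a finite set, nonempty when n > 0, hence a minimum:
   see [mst_weight_min]. *)
Definition mst_weight (R : realType) (n : nat) (x : edge n -> R) : R :=
  inf [set \sum_(e in T) x e | T in @spanning_tree n].

Section star.
Variable n : nat.

Let star : {set edge n.+1} := [set e : edge n.+1 | ord0 \in (val e : {set 'I_n.+1})]%SET.

Let adj_star u v : adj star u v = (u != v) && ((u == ord0) || (v == ord0)).
Proof.
apply/existsP/andP => [[e /andP[]]|[uv u0]].
  rewrite inE => e0 /eqP eE; move: e0 (valP e); rewrite eE !inE cards2.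
  rewrite (eq_sym ord0 u) (eq_sym ord0 v) => u0 uv2; split=> //.
  by case: (u =P v) uv2.
have uv2 : (#|[set u; v]%SET| == 2)%N by rewrite cards2 uv.
exists (exist _ [set u; v]%SET uv2).
by rewrite !inE /= (eq_sym ord0 u) (eq_sym ord0 v) u0 /=.
Qed.

Lemma spanning_tree_exists : exists T : {set edge n.+1}, spanning_tree T.
Proof.
exists star; split => //.
  have c0 u : connect (adj star) ord0 u && connect (adj star) u ord0.
    have [->|u0] := eqVneq u ord0; first by rewrite connect0.
    by rewrite !connect1 // adj_star eqxx ?orbT andbT // eq_sym.
  move=> u v; have /andP[_ h1] := c0 u; have /andP[h2 _] := c0 v.
  exact: connect_trans h1 h2.
move=> [|a [|b [|c s]]] //= _ /andP[].
rewrite /= rcons_path /= !adj_star !inE !negb_or.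
move=> /and4P[/andP[_ ab0] /andP[_ bc0] _ /andP[_ la0]].
move=> /and4P[/and3P[ab ac as_] /andP[bc bs] cs us].
have [b0|b0] := eqVneq b ord0; last first.
  move: ab0 bc0; rewrite (negbTE b0) orbF /= => /eqP a0 /eqP c0.
  by rewrite a0 c0 eqxx in ac.
have a0 : a != ord0 by rewrite -b0.
move: la0; rewrite (negbTE a0) orbF -b0 => /eqP lb.
have := mem_last c s; rewrite lb inE (negbTE bs) orbF.
by rewrite (negbTE bc).
Qed.

End star.

Lemma mst_weight_min (R : realType) (n : nat) (x : edge n -> R) : (0 < n)%N ->
  (exists2 T, spanning_tree T & mst_weight x = \sum_(e in T) x e) /\
  (forall T, spanning_tree T -> mst_weight x <= \sum_(e in T) x e).
Proof.
case: n x => // n x _.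
have [T0 hT0] := spanning_tree_exists n.
have hT0b : `[< spanning_tree T0 >] by apply/asboolP.
case: (@arg_minP _ _ _ T0 (fun T => `[< spanning_tree T >])
  (fun T => \sum_(e in T) x e) hT0b) => T /asboolP hT Tmin.
have lbT T' : spanning_tree T' -> \sum_(e in T) x e <= \sum_(e in T') x e.
  by move=> hT'; apply: Tmin; apply/asboolP.
suff -> : mst_weight x = \sum_(e in T) x e by split; [exists T|].
apply/eqP; rewrite eq_le; apply/andP; split.
  apply: ge_inf; last by exists T.
  by exists (\sum_(e in T) x e) => _ [T' hT' <-]; exact: lbT.
apply: lb_le_inf; first by exists (\sum_(e in T) x e), T.
by move=> _ [T' hT' <-]; exact: lbT.
Qed.

Definition independent_RVs (R : realType) (d : measure_display)
    (Omega : measurableType d) (P : probability Omega R) (I : finType)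
    (X : I -> {RV P >-> R}) : Prop :=
  forall (J : {set I}) (B : I -> set R), (forall i, measurable (B i)) ->
    P (\bigcap_(i in [set` J]) (X i @^-1` B i)) =
    (\prod_(i in J) P (X i @^-1` B i))%E.

(* X has the law of U^{1/q} with U uniform on (0, 1). *)
Definition uniform_root_law (R : realType) (q : R) (d : measure_display)
    (Omega : measurableType d) (P : probability Omega R)
    (X : {RV P >-> R}) : Prop :=
  forall A : set R, measurable A ->
    distribution P X A =
    pushforward (uniform_prob (@ltr01 R)) (fun u : R => u `^ q^-1) A.

Section stochastic_landau.
Variables (R : realType) (d : nat -> measure_display).
Variables (Omega : forall n, measurableType (d n)).
Variable P : forall n, probability (Omega n) R.

Definition bigO_prob (X Y : forall n, Omega n -> R) : Prop :=
  forall eps : R, 0 < eps -> exists2 C : R, 0 < C &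
    \forall n \near \oo,
      ((1 - eps)%:E <= P n [set w | (X n w <= C * Y n w)%R])%E.

Definition littleo_prob (X Y : forall n, Omega n -> R) : Prop :=
  forall eps : R, 0 < eps ->
    P n [set w | eps < `|X n w / Y n w|] @[n --> \oo] --> 0%E.

End stochastic_landau.

(* Main.v *)
(** Kruskal's algorithm gives [M = \int_0^oo (kappa(G_t) - 1) dt], where [G_t] is the
    graph of the edges of weight at most [t] and [kappa] counts its components; [G_t]
    is an Erdos-Renyi graph with edge probability [t^q].  Rescaling [t = n^(-1/q) s], the
    limit is [c_q = \int_0^oo f(s^q) ds], where [f(c)] is the limit of
    [E kappa(G(n, c/n)) / n], namely [f(c) = \sum_k T_k c^(k-1) e^(-kc) / k!] with [T_k]
    the number of trees on [k] labelled vertices.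

    Comparing the two sums over component sizes term by term up to [k = sqrt n / (1 + c)],
    and using only [\sum_k k f_k <= 1] (the sizes of the components add up to [n]), the
    bias of [kappa / n] is [O((1 + c) / sqrt n)].  The Efron-Stein inequality bounds the
    variance of [kappa] by the expected number of edges.  Finally [G_t] is connected with
    high probability once [s >= J = n^eta] for any fixed [eta > 0], and [f] has
    exponential tails, so only [s <= J] matters and the total relative error is
    [O(J^(1+q) / sqrt n)], which is [n^(-q/(2(q+1)))] for [eta = 1/(2(q+1)^2)]. *)

Require Import Defs.
From HB Require Import structures.
From mathcomp Require Import all_boot zify.

Set Implicit Arguments.
Unset Strict Implicit.
Unset Printing Implicit Defensive.

(** * Connected components and forests *)

Lemma connect_ind (T : finType) (r : rel T) (Q : T -> Prop) x :
  Q x -> (forall y z, Q y -> r y z -> Q z) ->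
  forall y, connect r x y -> Q y.
Proof.
move=> Qx Qr y /connectP[p]; elim: p x Qx => [|z p IH] x Qx /= => [_ -> //|].
by case/andP => /(Qr _ _ Qx)/IH; apply.
Qed.

Section components.
Variable n : nat.
Implicit Types (E F G : {set edge n}) (e : edge n) (u v w a b : 'I_n).
Implicit Types (S : {set 'I_n}).

Lemma edge_ends e : exists a b, a != b /\ val e = [set a; b].
Proof. by have /cards2P[a [b [ab eE]]] := valP e; exists a, b. Qed.

Lemma edge_ends_neq e a b : val e = [set a; b] -> a != b.
Proof. by move=> eE; have := valP e; rewrite eE cards2; case: (a != b). Qed.

Lemma exists_edge u v : u != v -> exists e : edge n, val e = [set u; v].
Proof.
move=> uv; have uv2 : #|[set u; v]| == 2 by rewrite cards2 uv.
by exists (exist _ [set u; v] uv2).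
Qed.

Lemma adjP E u v :
  reflect (exists2 e, e \in E & val e = [set u; v]) (adj E u v).
Proof.
by apply: (iffP exists_inP) => -[e eE /eqP eS]; exists e => //; exact/eqP.
Qed.

Lemma adj_sym E : symmetric (adj E).
Proof. by move=> u v; rewrite /adj setUC. Qed.

Lemma adj_subset E F u v : E \subset F -> adj E u v -> adj F u v.
Proof. by move=> /subsetP EF /adjP[e /EF eF eE]; apply/adjP; exists e. Qed.

Lemma adj_setU1 E e a b u v : val e = [set a; b] -> adj (e |: E) u v ->
  [\/ adj E u v, u = a /\ v = b | u = b /\ v = a].
Proof.
move=> eE /adjP[f]; rewrite !inE => /predU1P[-> | fE] fuv; last first.
  by constructor 1; apply/adjP; exists f.
have uv := edge_ends_neq fuv; move: fuv; rewrite eE => /setP abuv.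
have := abuv u; have := abuv v; rewrite !inE !eqxx orbT /=.
case/orP => /eqP vE /orP[] /eqP uE; move: uv; rewrite uE vE ?eqxx // => _.
  by constructor 3.
by constructor 2.
Qed.

Lemma connect_adj_sym E : connect_sym (adj E).
Proof. exact/sym_connect_sym/adj_sym. Qed.

Lemma connect_subset E F u v :
  E \subset F -> connect (adj E) u v -> connect (adj F) u v.
Proof.
by move=> EF; apply: connect_sub => x y xy; apply/connect1/(adj_subset EF).
Qed.

Lemma connect_setU1 E e a b u v : val e = [set a; b] ->
  connect (adj (e |: E)) u v ->
  [\/ connect (adj E) u v,
      connect (adj E) u a /\ connect (adj E) b v |
      connect (adj E) u b /\ connect (adj E) a v].
Proof.
move=> eE; move: v; apply: connect_ind; first by constructor 1.
move=> v w uv /(adj_setU1 eE) [/connect1 vw | [va wb] | [vb wa]].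
- case: uv => [uv | [ua bv] | [ub av]].
  + by constructor 1; exact: connect_trans vw.
  + by constructor 2; split=> //; exact: connect_trans vw.
  + by constructor 3; split=> //; exact: connect_trans vw.
- subst v w; case: uv => [ua | [ua _] | [ub _]].
  + by constructor 2.
  + by constructor 2.
  + by constructor 1.
- subst v w; case: uv => [ub | [ua _] | [ub _]].
  + by constructor 3.
  + by constructor 1.
  + by constructor 3.
Qed.

Definition component E v : {set 'I_n} := [set u | connect (adj E) v u].
Definition components E : {set {set 'I_n}} := component E @: [set: 'I_n].
Definition kappa E : nat := #|components E|.

Lemma mem_component E u v : (u \in component E v) = connect (adj E) v u.
Proof. by rewrite inE. Qed.

Lemma component_refl E v : v \in component E v.
Proof. by rewrite inE. Qed.

Lemma eq_component E u v :
  (component E u == component E v) = connect (adj E) u v.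
Proof.
apply/eqP/idP => [uvE|uv]; first by rewrite -mem_component uvE component_refl.
by apply/setP => w; rewrite !inE (same_connect (@connect_adj_sym E) uv).
Qed.

Lemma component_in E v : component E v \in components E.
Proof. exact: imset_f. Qed.

Lemma componentsP E S :
  reflect (exists v, S = component E v) (S \in components E).
Proof. by apply: (iffP imsetP) => [[v _ ->]|[v ->]]; exists v. Qed.

Lemma sum_card_components E : \sum_(S in components E) #|S| = n.
Proof.
rewrite -[RHS](card_ord n) -cardsT; apply/esym/card_partition.
have -> : components E = equivalence_partition (connect (adj E)) [set: 'I_n].
  by apply: eq_imset => v; apply/setP => u; rewrite !inE.
apply: equivalence_partitionP => u v w _ _ _; split=> // uv.
exact: (same_connect (@connect_adj_sym E) uv).
Qed.

Lemma kappa_set0 : kappa set0 = n.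
Proof.
rewrite /kappa card_imset ?cardsT ?card_ord // => u v /eqP.
rewrite eq_component => /connectP[[_ -> //|w p /= /andP[/adjP[e]]]].
by rewrite inE.
Qed.

Lemma kappa_gt0 E : 0 < n -> 0 < kappa E.
Proof.
by move=> n0; apply/card_gt0P; exists (component E (Ordinal n0)); exact: component_in.
Qed.

Lemma eq_connect_kappa E F :
  connect (adj E) =2 connect (adj F) -> kappa E = kappa F.
Proof.
move=> EF; congr #|pred_of_set _|; apply: eq_imset => v.
by apply/setP => u; rewrite !inE EF.
Qed.

Definition coarsen F S : {set 'I_n} := \bigcup_(v in S) component F v.

Lemma coarsen_component E F v :
  E \subset F -> coarsen F (component E v) = component F v.
Proof.
move=> EF; apply/setP => w; apply/bigcupP/idP => [[u]|vw].
  by rewrite !mem_component => /(connect_subset EF); exact: connect_trans.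
by exists v => //; exact: component_refl.
Qed.

Lemma components_coarsen E F :
  E \subset F -> components F = coarsen F @: components E.
Proof.
move=> EF; rewrite /components -imset_comp.
by apply: eq_imset => v; rewrite /= coarsen_component.
Qed.

Lemma kappa_subset E F : E \subset F -> kappa F <= kappa E.
Proof. by move/components_coarsen => H; rewrite /kappa H leq_imset_card. Qed.

Lemma kappa_setU1_ge E e : kappa E <= (kappa (e |: E)).+1.
Proof.
have [a [b [_ eE]]] := edge_ends e.
rewrite /kappa (cardsD1 (component E b)) component_in add1n ltnS.
rewrite (components_coarsen (subsetUr [set e] E)).
rewrite -(@card_in_imset _ _ (coarsen (e |: E)) (components E :\ component E b)).
  by apply/subset_leq_card/imsetS; exact: subsetDl.
move=> C D /setD1P[Cb /componentsP[u uE]] /setD1P[Db /componentsP[v vE]].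
rewrite uE vE !eq_component in Cb Db *; rewrite !coarsen_component ?subsetUr // => /eqP.
rewrite eq_component => /(connect_setU1 eE) [uv | [_ bv] | [ub _]].
- by apply/eqP; rewrite eq_component.
- by rewrite connect_adj_sym bv in Db.
- by rewrite ub in Cb.
Qed.

Lemma kappa_setU1_lt E e a b : val e = [set a; b] -> ~~ connect (adj E) a b ->
  kappa (e |: E) < kappa E.
Proof.
move=> eE; rewrite /kappa (components_coarsen (subsetUr [set e] E)).
rewrite ltn_neqAle leq_imset_card andbT -eq_component.
apply: contra => /imset_injP inj; apply/eqP/inj; rewrite ?component_in //.
rewrite !coarsen_component ?subsetUr //; apply/eqP; rewrite eq_component.
by apply/connect1/adjP; exists e => //; exact: setU11.
Qed.

Lemma kappa_setU1_eq E e a b : val e = [set a; b] -> connect (adj E) a b ->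
  kappa (e |: E) = kappa E.
Proof.
move=> eE ab; apply: eq_connect_kappa => u v; apply/idP/idP; last first.
  exact/connect_subset/subsetUr.
case/(connect_setU1 eE) => [// | [ua bv] | [ub av]].
  by apply: connect_trans ua (connect_trans ab bv).
by apply: connect_trans ub (connect_trans _ av); rewrite connect_adj_sym.
Qed.

Lemma kappa_setU_ge E F : kappa E <= kappa (F :|: E) + #|F|.
Proof.
have [m] := ubnP #|F|; elim: m F => // m IH F.
have [->|[e eF]] := set_0Vmem F; first by rewrite set0U cards0 addn0.
rewrite (cardsD1 e) eF add1n ltnS => Fm.
apply: leq_trans (IH _ Fm) _; rewrite addnS -addSn leq_add2r.
by rewrite -{2}(setD1K eF) -setUA; exact: kappa_setU1_ge.
Qed.

Lemma card_add_kappa_ge E : n <= #|E| + kappa E.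
Proof. by have := kappa_setU_ge set0 E; rewrite kappa_set0 setU0 addnC. Qed.

Lemma connected_graph_kappa E :
  0 < n -> connected_graph E <-> kappa E <= 1.
Proof.
move=> n0; split=> [conE|/card_le1_eqP k1 u v]; last first.
  by rewrite -eq_component; apply/eqP/k1; exact: component_in.
apply/card_le1_eqP => _ _ /componentsP[u ->] /componentsP[v ->].
by apply/eqP; rewrite eq_component.
Qed.

Definition forest F := #|F| + kappa F == n.

Lemma forest_set0 : forest set0.
Proof. by rewrite /forest cards0 kappa_set0. Qed.

Lemma forest_setU1 F e a b : val e = [set a; b] -> ~~ connect (adj F) a b ->
  forest F -> forest (e |: F).
Proof.
move=> eE nab /eqP fF.
have eF : e \notin F.
  by apply: contra nab => eF; apply/connect1/adjP; exists e.
have := kappa_setU1_lt eE nab; have := card_add_kappa_ge (e |: F).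
by rewrite /forest cardsU1 eF; lia.
Qed.

Lemma forest_extend F G : forest F -> F \subset G ->
  exists F', [/\ forest F', F \subset F', F' \subset G &
    connect (adj G) =2 connect (adj F')].
Proof.
have [m] := ubnP #|G :\: F|; elim: m F => // m IH F Gm fF FG.
pose bridge e a b := (val e == [set a; b]) && ~~ connect (adj F) a b.
have [/exists_inP[e eG /existsP[a /existsP[b /andP[/eqP eE nab]]]]|noBridge] :=
  boolP [exists e in G, exists a, exists b, bridge e a b].
  have eF : e \notin F.
    by apply: contra nab => eF; apply/connect1/adjP; exists e.
  have [|||F' [fF' FF' F'G conF']] := IH (e |: F).
  - rewrite (@leq_trans #|G :\: F|) //; apply: proper_card.
    by rewrite setUC -setDDl properD1 // !inE eF.
  - exact: forest_setU1 nab fF.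
  - by rewrite subUset sub1set eG.
  by exists F'; split=> //; exact: subset_trans (subsetUr _ _) FF'.
exists F; split=> // u v; apply/idP/idP; last exact: connect_subset.
apply: connect_sub => {u v} u v /adjP[e eG eE]; apply: contraNT noBridge => nuv.
apply/exists_inP; exists e => //; apply/existsP; exists u; apply/existsP.
by exists v; rewrite /bridge eE eqxx.
Qed.

Lemma ucycle_connect_setD1 E e a b p : val e = [set a; b] -> p != [::] ->
  ucycle (adj E) [:: a, b & p] -> connect (adj (E :\ e)) b a.
Proof.
move=> eE p_neq0 /andP[/= /andP[_]]; rewrite rcons_path => /andP[bp lpa].
rewrite inE negb_or => /andP[/andP[ab ap] /andP[bNp _]].
have avoid x y : adj E x y -> [set x; y] != [set a; b] -> adj (E :\ e) x y.
  move=> /adjP[f fE fxy] xyab; apply/adjP; exists f => //; rewrite !inE fE andbT.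
  by apply: contra xyab => /eqP fe; rewrite -fxy -eE fe.
apply: (@connect_trans _ _ (last b p)).
  apply/connectP; exists p => //.
  apply: (@sub_in_path _ (predC1 a) (adj E)) bp => [x y xa ya /avoid|]; last first.
    by rewrite /= eq_sym ab; apply/allP => x xp; apply: contraNneq ap => <-.
  apply; apply: contraTneq xa => /setP/(_ a).
  by rewrite !inE eqxx (eq_sym a x) (eq_sym a y) (negPf ya) orbF => ->.
apply/connect1/(avoid _ _ lpa); have lp : last b p \in p.
  by case: (p) p_neq0 => //= c s _; exact: mem_last.
apply/eqP => /setP/(_ b); rewrite !inE eqxx orbT (eq_sym b a) (negPf ab).
by rewrite orbF => /eqP bl; rewrite bl lp in bNp.
Qed.

Lemma forest_acyclic F : forest F -> acyclic F.
Proof.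
move=> /eqP fF [|a [|b [|c s]]] // _ cyc.
have /adjP[e eF eE] : adj F a b by case/andP: cyc => /andP[].
have ab : connect (adj (F :\ e)) a b.
  by rewrite connect_adj_sym; apply: ucycle_connect_setD1 eE _ cyc.
have := kappa_setU1_eq eE ab; have := card_add_kappa_ge (F :\ e).
by move: fF; rewrite setD1K // (cardsD1 e F) eF; lia.
Qed.

Lemma connected_kappa_le_cardsD T G : 0 < n -> connected_graph T ->
  kappa G <= #|T :\: G|.+1.
Proof.
move=> n0 /(connected_graph_kappa _ n0) kT; have := kappa_setU_ge G (T :\: G).
have : kappa (T :\: G :|: G) <= kappa T; last lia.
apply: kappa_subset; apply/subsetP => e eT; rewrite !inE eT andbT.
exact: orNb.
Qed.

Lemma chain_spanning_forest (G : nat -> {set edge n}) N :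
  (forall i j, i <= j -> G i \subset G j) ->
  exists F, [/\ forest F, F \subset G N,
    connect (adj (G N)) =2 connect (adj F) &
    forall j, j <= N -> n <= #|F :&: G j| + kappa (G j)].
Proof.
move=> G_mono; elim: N => [|N [F [fF FG conF FGj]]].
  have [F [fF _ FG conF]] := forest_extend forest_set0 (sub0set (G 0)).
  exists F; split=> // j; rewrite leqn0 => /eqP->.
  by rewrite (setIidPl FG) (eq_connect_kappa conF) (eqP fF).
have [F' [fF' FF' FG' conF']] :=
  forest_extend fF (subset_trans FG (G_mono _ _ (leqnSn N))).
exists F'; split=> // j; rewrite leq_eqVlt => /predU1P[->|].
  by rewrite (setIidPl FG') (eq_connect_kappa conF') (eqP fF').
rewrite ltnS => /FGj nFG; apply: leq_trans nFG _; rewrite leq_add2r.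
exact/subset_leq_card/setSI.
Qed.

Lemma connected_graph_setT : connected_graph [set: edge n].
Proof.
move=> u v; have [->|uv] := eqVneq u v; first exact: connect0.
by have [e eE] := exists_edge uv; apply/connect1/adjP; exists e.
Qed.

Lemma chain_spanning_tree (G : nat -> {set edge n}) N : 0 < n ->
  (forall i j, i <= j -> G i \subset G j) -> G N = [set: edge n] ->
  exists2 T, spanning_tree T &
    forall j, j <= N -> #|T :\: G j| = (kappa (G j)).-1.
Proof.
move=> n0 G_mono GN.
have [T [fT _ conT TG]] := chain_spanning_forest N G_mono.
have cT : connected_graph T.
  by move=> u v; rewrite -conT GN; exact: connected_graph_setT.
exists T => [|j jN]; first by split=> //; exact: forest_acyclic.
have := TG j jN; have := cardsID (G j) T; have := eqP fT.
have := connected_kappa_le_cardsD (G j) n0 cT; have := kappa_gt0 (G j) n0.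
by have /(connected_graph_kappa _ n0) := cT; have := kappa_gt0 T n0; lia.
Qed.
End components.

(** * Trees spanning a set of vertices *)

Section trees_on.
Variable n : nat.
Implicit Types (A E G : {set edge n}) (e : edge n) (u v w a b : 'I_n).
Implicit Types (S : {set 'I_n}).

Definition edges_in S : {set edge n} :=
  [set e : edge n | (val e : {set 'I_n}) \subset S].
Definition edges_at S : {set edge n} :=
  [set e : edge n | (val e : {set 'I_n}) :&: S != set0].
Definition cut S : {set edge n} := edges_at S :\: edges_in S.

Definition trees_on S : {set {set edge n}} :=
  [set A : {set edge n} | [&& A \subset edges_in S, #|A|.+1 == #|S| &
    [forall u in S, forall v in S, connect (adj A) u v]]].

Lemma trees_onP S A : reflect [/\ A \subset edges_in S, #|A|.+1 = #|S| &
    {in S &, forall u v, connect (adj A) u v}] (A \in trees_on S).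
Proof.
rewrite inE; apply: (iffP and3P) => -[AS /eqP cA conA]; split=> //.
  by move=> u v uS vS; exact: (forall_inP (forall_inP conA u uS) v vS).
by apply/forall_inP => u uS; apply/forall_inP => v; exact: conA.
Qed.

Lemma mem_edges_in e u v S :
  val e = [set u; v] -> (e \in edges_in S) = (u \in S) && (v \in S).
Proof. by move=> eE; rewrite inE eE subUset !sub1set. Qed.

Lemma mem_edges_at e u v S :
  val e = [set u; v] -> (e \in edges_at S) = (u \in S) || (v \in S).
Proof.
move=> eE; rewrite inE eE; apply/set0Pn/orP => [[a]|[uS|vS]].
- by rewrite !inE => /andP[/orP[] /eqP ->]; [left|right].
- by exists u; rewrite !inE eqxx.
- by exists v; rewrite !inE eqxx orbT.
Qed.

Lemma edges_in_subset_at S : edges_in S \subset edges_at S.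
Proof.
apply/subsetP => e; have [u [v [_ eE]]] := edge_ends e.
by rewrite (mem_edges_in _ eE) (mem_edges_at _ eE) => /andP[->].
Qed.

Lemma disjoint_cut_component E v : [disjoint cut (component E v) & E].
Proof.
rewrite disjoint_subset; apply/subsetP => e; have [a [b [_ eE]]] := edge_ends e.
rewrite in_setD (mem_edges_in _ eE) (mem_edges_at _ eE) !mem_component inE.
move=> /andP[nab vab]; apply: contra nab => eF.
have ab : connect (adj E) a b by apply/connect1/adjP; exists e.
case/orP: vab => [va | vb]; first by rewrite va (connect_trans va ab).
by rewrite vb (connect_trans vb) // connect_adj_sym.
Qed.

Lemma connect_edges_in_component E v u : connect (adj E) v u ->
  connect (adj (E :&: edges_in (component E v))) v u.
Proof.
move=> vu; suff [] : connect (adj E) v u /\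
  connect (adj (E :&: edges_in (component E v))) v u by [].
move: u vu; apply: connect_ind => // a b [va va'] ab.
have vb : connect (adj E) v b by exact: connect_trans va (connect1 ab).
split=> //; apply: connect_trans va' (connect1 _).
case/adjP: (ab) => e eE abE; apply/adjP; exists e => //.
by rewrite in_setI eE (mem_edges_in _ abE) !mem_component va.
Qed.

Lemma component_edges_in G S u : G \subset edges_in S ->
  {in S &, forall v w, connect (adj G) v w} ->
  component G u = if u \in S then S else [set u].
Proof.
move=> /subsetP GS conS; apply/setP => w; rewrite mem_component.
have adjS a b : adj G a b -> (a \in S) && (b \in S).
  by move=> /adjP[e /GS eS abE]; rewrite (mem_edges_in _ abE) in eS.
case: ifPn => uS; apply/idP/idP.
- by move: w; apply: connect_ind => // a b _ /adjS/andP[].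
- exact: conS.
- move: w; apply: connect_ind; first exact: set11.
  by move=> a b /set1P -> /adjS; rewrite (negPf uS).
- by move/set1P ->.
Qed.

Lemma kappa_edges_in G S : S != set0 -> G \subset edges_in S ->
  {in S &, forall v w, connect (adj G) v w} -> kappa G = (n - #|S|).+1.
Proof.
move=> /set0Pn[s sS] GS conS; have compG u := component_edges_in u GS conS.
have -> : kappa G = #|S |: [set [set x] | x in ~: S]|.
  congr #|pred_of_set _|; apply/setP => C.
  apply/componentsP/setU1P => [[u ->]|[->|/imsetP[x xS ->]]].
  - by rewrite compG; case: ifPn => uS; [left|right; rewrite imset_f ?inE].
  - by exists s; rewrite compG sS.
  - by exists x; rewrite compG; move: xS; rewrite inE => /negPf->.
rewrite cardsU1 card_imset; last exact: set1_inj.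
rewrite cardsCs setCK card_ord; case: imsetP => //= -[x xS Sx].
by move: xS; rewrite inE Sx set11.
Qed.

Lemma components_cut_tree E S : S \in components E ->
  [disjoint cut S & E] /\ exists2 A, A \in trees_on S & A \subset E.
Proof.
move=> /componentsP[v ->]; split; first exact: disjoint_cut_component.
have [A [fA _ AES conA]] :=
  forest_extend (forest_set0 n) (sub0set (E :&: edges_in (component E v))).
have conS : {in component E v &, forall a b, connect (adj A) a b}.
  move=> a b; rewrite !mem_component -conA => va vb.
  apply: (@connect_trans _ _ v); last exact: connect_edges_in_component.
  by rewrite connect_adj_sym; exact: connect_edges_in_component.
have /subsetIP[AE AS] := AES; exists A => //; apply/trees_onP; split=> //.
have S0 : component E v != set0 by apply/set0Pn; exists v; exact: component_refl.
have : #|component E v| <= n by rewrite -[X in _ <= X]card_ord max_card.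
by move: fA; rewrite /forest (kappa_edges_in S0 AS conS) => /eqP; lia.
Qed.

Lemma tree_component E S A :
  A \in trees_on S -> E :&: edges_at S = A -> S \in components E.
Proof.
case/trees_onP => AS cA conA EA.
have /card_gt0P[v vS] : 0 < #|S| by rewrite -cA.
apply/componentsP; exists v; apply/setP => u; rewrite mem_component.
apply/idP/idP => [uS|].
  by apply: connect_subset (conA _ _ vS uS); rewrite -EA subsetIl.
move: u; apply: connect_ind => // a b aS /adjP[e eE abE].
have : e \in A by rewrite -EA in_setI eE (mem_edges_at _ abE) aS.
by move/(subsetP AS); rewrite (mem_edges_in _ abE) => /andP[].
Qed.

Lemma card_cut_ge S : #|S| * (n - #|S|) <= #|cut S|.
Proof.
have -> : n - #|S| = #|~: S| by rewrite [RHS]cardsCs setCK card_ord.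
pose pair (p : 'I_n * 'I_n) := [set p.1; p.2].
rewrite -cardsX -(@card_in_imset _ _ pair); last first.
  move=> [x y] [x' y'] /setXP[/= xS +] /setXP[/= xS' +].
  rewrite !inE => yS yS' /setP pE; have := pE x; have := pE y.
  rewrite !inE !eqxx orbT /=.
  move=> /esym/orP[/eqP yx'|/eqP <-]; first by rewrite yx' xS' in yS.
  by move=> /esym/orP[/eqP <- // | /eqP xy]; rewrite -xy xS in yS.
apply: leq_trans (leq_imset_card val (cut S)).
apply/subset_leq_card/subsetP => _ /imsetP[[x y] /setXP[/= xS yS] ->].
rewrite inE in yS; have xy : x != y by apply: contraNneq yS => <-.
have [e eE] := exists_edge xy; apply/imsetP; exists e => //.
by rewrite in_setD (mem_edges_in _ eE) (mem_edges_at _ eE) xS (negPf yS).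
Qed.

Lemma card_edges_at_le S : #|edges_at S| <= #|S| * n.
Proof.
pose pair (p : 'I_n * 'I_n) := [set p.1; p.2].
rewrite -[X in _ * X]card_ord -cardsT -cardsX.
rewrite -(card_imset _ (val_inj : injective (val : edge n -> _))).
apply: leq_trans (leq_imset_card pair _).
apply/subset_leq_card/subsetP => _ /imsetP[e eS ->].
have [x [y [_ eE]]] := edge_ends e; move: eS; rewrite eE (mem_edges_at _ eE).
case/orP => [xS | yS]; first by apply/imsetP; exists (x, y); rewrite ?inE ?xS.
by apply/imsetP; exists (y, x); rewrite ?inE ?yS // /pair setUC.
Qed.

Lemma card_edge_le : #|{: edge n}| <= n * n.
Proof.
have := card_edges_at_le [set: 'I_n]; rewrite cardsT card_ord.
apply: leq_trans; rewrite -cardsT; apply/subset_leq_card/subsetP => e _.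
by have [u [v [_ eE]]] := edge_ends e; rewrite (mem_edges_at _ eE) inE.
Qed.

Lemma disconnected_cut E : 1 < kappa E ->
  exists S, [/\ S != set0, #|S|.*2 <= n & [disjoint cut S & E]].
Proof.
move=> /card_gt1P[S1 [S2 [S1E S2E S12]]].
have [S SE Sn] : exists2 S, S \in components E & #|S|.*2 <= n.
  have S12n : #|S1| + #|S2| <= n.
    rewrite -[X in _ <= X](sum_card_components E) (bigD1 S1) //= leq_add2l.
    by rewrite (bigD1 S2) /= ?leq_addr // S2E eq_sym.
  case: (leqP #|S1| #|S2|) => [le12 | /ltnW le21]; [exists S1 | exists S2] => //.
    by rewrite -addnn (leq_trans _ S12n) // leq_add2l.
  by rewrite -addnn (leq_trans _ S12n) // leq_add2r.
exists S; split=> //; last by case: (components_cut_tree SE).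
by case/componentsP: SE => v ->; apply/set0Pn; exists v; exact: component_refl.
Qed.
End trees_on.

Definition ntrees k : nat := #|trees_on [set: 'I_k]|.

Lemma ntrees0 : ntrees 0 = 0.
Proof.
apply: eq_card0 => A; apply/negbTE/negP => /trees_onP[_ + _].
by rewrite cardsT card_ord.
Qed.

Lemma ntrees1_gt0 : 0 < ntrees 1.
Proof.
apply/card_gt0P; exists set0; apply/trees_onP; split; first exact: sub0set.
  by rewrite cards0 cardsT card_ord.
by move=> u v _ _; rewrite (ord1 u) (ord1 v).
Qed.

Section relabelling.
Variables (k n : nat) (phi : 'I_k -> 'I_n).
Hypothesis phi_inj : injective phi.
Implicit Types (A : {set edge k}) (e : edge k).

Lemma card_edge_imset e : #|phi @: val e| == 2.
Proof. by rewrite card_imset // (valP e). Qed.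

Definition edge_map e : edge n := exist _ (phi @: val e) (card_edge_imset e).

Lemma edge_map_inj : injective edge_map.
Proof. by move=> e e' [/(imset_inj phi_inj) ee]; apply: val_inj. Qed.

Lemma edge_map_ends e u v :
  (val (edge_map e) == [set phi u; phi v]) = (val e == [set u; v]).
Proof.
have <- : phi @: [set u; v] = [set phi u; phi v] by rewrite imsetU !imset_set1.
by rewrite (inj_eq (imset_inj phi_inj)).
Qed.

Lemma adj_edge_map A u v : adj (edge_map @: A) (phi u) (phi v) = adj A u v.
Proof.
apply/adjP/adjP => [[_ /imsetP[e eA ->] /eqP eE]|[e eA /eqP eE]].
  by exists e => //; apply/eqP; rewrite -edge_map_ends.
by exists (edge_map e); [exact: imset_f|apply/eqP; rewrite edge_map_ends].
Qed.

Lemma adj_edge_map_range A a b : adj (edge_map @: A) a b -> b \in codom phi.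
Proof.
case/adjP => _ /imsetP[e _ ->] /setP/(_ b); rewrite !inE eqxx orbT.
by move=> /imsetP[v _ ->]; exact: codom_f.
Qed.

Lemma connect_edge_map A u v :
  connect (adj (edge_map @: A)) (phi u) (phi v) = connect (adj A) u v.
Proof.
apply/idP/idP => [uv|].
  suff [w /phi_inj -> //] : exists2 w, phi v = phi w & connect (adj A) u w.
  move: (phi v) uv; apply: connect_ind; first by exists u.
  move=> _ b [w -> uw] wb; have /codomP[w' bE] := adj_edge_map_range wb.
  exists w' => //; apply: connect_trans uw (connect1 _).
  by rewrite -adj_edge_map -bE.
move: v; apply: connect_ind => // a b ua ab.
by apply: connect_trans ua (connect1 _); rewrite adj_edge_map.
Qed.

Lemma mem_trees_on_edge_map A :
  (edge_map @: A \in trees_on (phi @: [set: 'I_k])) = (A \in trees_on [set: 'I_k]).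
Proof.
apply/trees_onP/trees_onP => -[_ cA conA]; split.
- by apply/subsetP => e _; rewrite inE subsetT.
- by move: cA; rewrite !card_imset //; exact: edge_map_inj.
- by move=> u v _ _; rewrite -connect_edge_map; apply: conA; exact: imset_f.
- by apply/subsetP => _ /imsetP[e _ ->]; rewrite inE; exact/imsetS/subsetT.
- by rewrite !card_imset //; exact: edge_map_inj.
- move=> _ _ /imsetP[u _ ->] /imsetP[v _ ->].
  by rewrite connect_edge_map; apply: conA; rewrite inE.
Qed.

Lemma edges_in_edge_map :
  edges_in (phi @: [set: 'I_k]) \subset edge_map @: [set: edge k].
Proof.
apply/subsetP => f; have [x [y [xy fE]]] := edge_ends f.
rewrite (mem_edges_in _ fE) => /andP[/imsetP[u _ xu] /imsetP[v _ yv]].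
have /exists_edge[e eE] : u != v by rewrite xu yv (inj_eq phi_inj) in xy.
apply/imsetP; exists e => //; apply/val_inj/esym/eqP.
by rewrite fE xu yv edge_map_ends eE.
Qed.

Lemma card_trees_on_imset : #|trees_on (phi @: [set: 'I_k])| = ntrees k.
Proof.
rewrite /ntrees -(card_imset (mem (trees_on _)) (imset_inj edge_map_inj)).
congr #|pred_of_set _|; apply/setP => B; apply/idP/imsetP => [BT|[A AT ->]].
  have /subset_trans/(_ edges_in_edge_map)/subsetP BE :
    B \subset edges_in (phi @: [set: 'I_k]) by case/trees_onP: BT.
  have B_imset : B = edge_map @: (edge_map @^-1: B).
    apply/setP => f; apply/idP/imsetP => [fB | [e + ->]]; last by rewrite inE.
    by have /imsetP[e _ fE] := BE _ fB; exists e; rewrite ?inE -?fE.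
  by exists (edge_map @^-1: B); rewrite // -mem_trees_on_edge_map -B_imset.
by rewrite mem_trees_on_edge_map.
Qed.
End relabelling.

Lemma card_trees_on n (S : {set 'I_n}) : #|trees_on S| = ntrees #|S|.
Proof.
rewrite -(@card_trees_on_imset _ _ _ (@enum_val_inj _ (mem S))).
congr #|pred_of_set (trees_on _)|; apply/setP => x.
apply/idP/imsetP => [xS|[i _ ->]]; last exact: enum_valP.
by exists (enum_rank_in xS x); rewrite ?inE // enum_rankK_in.
Qed.

From mathcomp Require Import all_order all_algebra ring lra.
Import Order.TTheory GRing.Theory Num.Theory.
Local Open Scope ring_scope.

(** * Random subsets with independent elements *)

Section bernoulli.
Variables (R : realFieldType) (I : finType).
Implicit Types (A B C E : {set I}) (g h : {set I} -> R) (p : R) (e : I).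

Definition bernoulli_weight p E : R := \prod_i (if i \in E then p else 1 - p).

Definition bernoulli_mean p h : R := \sum_E bernoulli_weight p E * h E.

Lemma bernoulli_weight_ge0 p E : 0 <= p <= 1 -> 0 <= bernoulli_weight p E.
Proof.
by move=> /andP[p0 p1]; apply: prodr_ge0 => i _; case: ifP => //; rewrite subr_ge0.
Qed.

Lemma bernoulli_mean_subset_disjoint p A B : [disjoint A & B] ->
  bernoulli_mean p (fun E => ((A \subset E) && [disjoint B & E])%:R) =
  p ^+ #|A| * (1 - p) ^+ #|B|.
Proof.
move=> AB; pose inside i := if i \in B then 0 else p.
pose outside i := if i \in A then 0 else 1 - p.
transitivity (\prod_i (inside i + outside i)).
  rewrite bigA_distr; apply: eq_bigr => E _.
  case: (boolP (_ && _)) => [/andP[AE BE]|].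
    rewrite mulr1; apply: eq_bigr => i _; rewrite /inside /outside; case: ifPn => iE.
      by rewrite (disjointFl BE iE).
    by rewrite ifN //; apply: contra iE; exact: (subsetP AE).
  rewrite mulr0 negb_and disjoint_subset => /orP[/subsetPn[i iA iE] | /subsetPn[i iB]].
    by rewrite (bigD1 i) //= (negPf iE) /outside iA mul0r.
  by rewrite inE negbK => iE; rewrite (bigD1 i) //= iE /inside iB mul0r.
transitivity (\prod_i ((if i \in A then p else 1) * (if i \in B then 1 - p else 1))).
  apply: eq_bigr => i _; rewrite /inside /outside; have [iA|iA] := boolP (i \in A).
    by rewrite (disjointFr AB iA) addr0 mulr1.
  by rewrite mul1r; case: ifP => _; rewrite ?add0r // addrC subrK.
by rewrite big_split /= -!big_mkcond /= !prodr_const.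
Qed.

Lemma sum_bernoulli_weight p : \sum_E bernoulli_weight p E = 1.
Proof.
have := @bernoulli_mean_subset_disjoint p set0 set0.
rewrite disjoints_subset sub0set !cards0 !expr0 mulr1 => <- //; apply: eq_bigr => E _.
by rewrite disjoints_subset !sub0set mulr1.
Qed.

Lemma bernoulli_mean_cst p (c : R) : bernoulli_mean p (fun=> c) = c.
Proof. by rewrite /bernoulli_mean -mulr_suml sum_bernoulli_weight mul1r. Qed.

Lemma eq_bernoulli_mean p g h : g =1 h -> bernoulli_mean p g = bernoulli_mean p h.
Proof. by move=> gh; apply: eq_bigr => E _; rewrite gh. Qed.

Lemma ler_bernoulli_mean p g h : 0 <= p <= 1 -> (forall E, g E <= h E) ->
  bernoulli_mean p g <= bernoulli_mean p h.
Proof.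
by move=> p01 gh; apply: ler_sum => E _; rewrite ler_wpM2l ?bernoulli_weight_ge0.
Qed.

Lemma bernoulli_mean_ge0 p h : 0 <= p <= 1 -> (forall E, 0 <= h E) ->
  0 <= bernoulli_mean p h.
Proof.
by move=> p01 h0; apply: sumr_ge0 => E _; rewrite mulr_ge0 ?bernoulli_weight_ge0.
Qed.

Lemma bernoulli_meanZ p (c : R) h :
  bernoulli_mean p (fun E => c * h E) = c * bernoulli_mean p h.
Proof.
by rewrite /bernoulli_mean mulr_sumr; apply: eq_bigr => E _; rewrite mulrCA.
Qed.

Lemma bernoulli_meanD p g h :
  bernoulli_mean p (fun E => g E + h E) = bernoulli_mean p g + bernoulli_mean p h.
Proof.
by rewrite /bernoulli_mean -big_split; apply: eq_bigr => E _; rewrite mulrDr.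
Qed.

Lemma bernoulli_mean_sum p (J : Type) (s : seq J) (Q : pred J)
    (h : J -> {set I} -> R) :
  bernoulli_mean p (fun E => \sum_(j <- s | Q j) h j E) =
  \sum_(j <- s | Q j) bernoulli_mean p (h j).
Proof.
by rewrite /bernoulli_mean exchange_big; apply: eq_bigr => E _; rewrite mulr_sumr.
Qed.

Lemma bernoulli_mean_setI p A C : A \subset C ->
  bernoulli_mean p (fun E => (E :&: C == A)%:R) =
  p ^+ #|A| * (1 - p) ^+ #|C :\: A|.
Proof.
move=> AC; rewrite -bernoulli_mean_subset_disjoint; last first.
  by rewrite disjoint_sym disjoints_subset setDE subsetIr.
apply: eq_bernoulli_mean => E; congr ((nat_of_bool _)%:R).
rewrite eq_sym eqEsubset subsetI AC andbT disjoints_subset setDE; congr (_ && _).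
apply/subsetP/subsetP => EA i; have := EA i; rewrite !inE;
  by case: (i \in E); case: (i \in C); case: (i \in A) => //= /(_ isT).
Qed.

Lemma bernoulli_mean_sqr_le p h : 0 <= p <= 1 ->
  bernoulli_mean p h ^+ 2 <= bernoulli_mean p (fun E => h E ^+ 2).
Proof.
move=> p01; set m := bernoulli_mean p h; rewrite -subr_ge0.
suff -> : bernoulli_mean p (fun E => h E ^+ 2) - m ^+ 2 =
    bernoulli_mean p (fun E => (h E - m) ^+ 2).
  by apply: bernoulli_mean_ge0 => // E; exact: sqr_ge0.
transitivity (bernoulli_mean p (fun E => h E ^+ 2 + ((- 2 * m) * h E + m ^+ 2))).
  by rewrite !bernoulli_meanD bernoulli_meanZ bernoulli_mean_cst -/m; ring.
by apply: eq_bernoulli_mean => E; ring.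
Qed.

Definition set_element e (b : bool) E : {set I} := if b then e |: E else E :\ e.
Arguments set_element : simpl never.

Lemma in_set_element e b E i :
  (i \in set_element e b E) = if i == e then b else i \in E.
Proof. by case: b; rewrite !inE; case: (i == e). Qed.

Lemma set_element_id e E : set_element e (e \in E) E = E.
Proof. by apply/setP => i; rewrite in_set_element; case: eqP => // ->. Qed.

Lemma set_element_set_element e b b' E :
  set_element e b (set_element e b' E) = set_element e b E.
Proof. by apply/setP => i; rewrite !in_set_element; case: eqP. Qed.

Lemma set_elementC e e' b b' E : e != e' ->
  set_element e b (set_element e' b' E) = set_element e' b' (set_element e b E).
Proof.
move=> ee'; apply/setP => i; rewrite !in_set_element.
by case: (i =P e) => // ->; rewrite (negPf ee').
Qed.

Definition coord_mean p e h E : R :=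
  p * h (set_element e true E) + (1 - p) * h (set_element e false E).

Lemma bernoulli_mean_coord_mean p e h :
  bernoulli_mean p (coord_mean p e h) = bernoulli_mean p h.
Proof.
pose w E := \prod_(i | i != e) (if i \in E then p else 1 - p).
have wE E : bernoulli_weight p E = (if e \in E then p else 1 - p) * w E.
  by rewrite /bernoulli_weight (bigD1 e).
have w_set b E : w (set_element e b E) = w E.
  by apply: eq_bigr => i /negPf ie; rewrite in_set_element ie.
have in_notin (f : {set I} -> R) :
    \sum_(E : {set I} | e \in E) f E = \sum_(E : {set I} | e \notin E) f (e |: E).
  rewrite (reindex_onto (fun E => e |: E) (fun E => E :\ e)) /=; last exact: setD1K.
  apply: eq_bigl => E; rewrite setU11 /=; apply/eqP/idP => [<-|]; last exact: setU1K.
  by rewrite !inE eqxx.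
rewrite /bernoulli_mean (bigID (fun E : {set I} => e \in E)) /= in_notin.
rewrite [RHS](bigID (fun E : {set I} => e \in E)) /= in_notin -!big_split /=.
apply: eq_bigr => E eE; rewrite -/(set_element e true E) /coord_mean !wE w_set.
rewrite in_set_element eqxx !set_element_set_element (negPf eE).
by have := set_element_id e E; rewrite (negPf eE) => ->; ring.
Qed.

Definition coords_mean p h (s : seq I) : {set I} -> R := foldr (coord_mean p) h s.

Lemma coords_mean_set_element p h s e b E : e \in s ->
  coords_mean p h s (set_element e b E) = coords_mean p h s E.
Proof.
elim: s E => //= e' s IH E; rewrite inE eq_sym /coord_mean.
have [-> _|/= e'e es] := eqVneq e' e; first by rewrite !set_element_set_element.
by rewrite !(set_elementC _ _ _ e'e) !IH.
Qed.

Lemma coords_mean_enum p h E : coords_mean p h (enum I) E = bernoulli_mean p h.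
Proof.
set g := coords_mean p h (enum I).
have g_set0 F : g F = g set0.
  have [m] := ubnP #|F|; elim: m F => // m IH F.
  have [->//|[e eF]] := set_0Vmem F; rewrite (cardsD1 e) eF add1n ltnS => Fm.
  by rewrite -(IH _ Fm) /g (@coords_mean_set_element _ _ _ e false) ?mem_enum.
rewrite g_set0 -(bernoulli_mean_cst p (g set0)) -(eq_bernoulli_mean p g_set0) /g.
by elim: (enum I) => //= e s IH; rewrite bernoulli_mean_coord_mean.
Qed.

Definition unit_differences h :=
  forall e E, `|h (set_element e true E) - h (set_element e false E)| <= 1.

Lemma coord_mean_unit_differences p e h : 0 <= p <= 1 ->
  unit_differences h -> unit_differences (coord_mean p e h).
Proof.
move=> /andP[p0 p1] h1 e' E; rewrite /coord_mean.
have [<-|ee'] := eqVneq e e'; first by rewrite !set_element_set_element subrr normr0.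
rewrite !(set_elementC _ _ _ ee').
have := h1 e' (set_element e true E); have := h1 e' (set_element e false E).
rewrite !ler_norml => /andP[a0 a1] /andP[b0 b1]; apply/andP; split; nra.
Qed.

(* Averaging over one more coordinate turns the mean of the square into the
   square of the mean at the cost of one Bernoulli variance. *)
Lemma efron_stein p h : 0 <= p <= 1 -> unit_differences h ->
  bernoulli_mean p (fun E => h E ^+ 2) <=
  bernoulli_mean p h ^+ 2 + #|I|%:R * (p * (1 - p)).
Proof.
move=> p01 h1; rewrite -(coords_mean_enum p _ set0) -(coords_mean_enum p h set0) cardE.
have /andP[p0 p1] := p01; have q0 : 0 <= 1 - p by rewrite subr_ge0.
elim: (enum I) set0 => [|e s IH] E /=; first by rewrite mul0r addr0.
rewrite /coord_mean; have := IH (set_element e true E); have := IH (set_element e false E).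
have /(_ e E) : unit_differences (coords_mean p h s).
  by elim: (s) => //= *; exact: coord_mean_unit_differences.
set a := coords_mean p h s _; set b := coords_mean p h s _.
rewrite -ler_sqr ?nnegrE // real_normK ?num_real // expr1n => ab1 le0 le1.
apply: le_trans (lerD (ler_wpM2l p0 le1) (ler_wpM2l q0 le0)) _.
rewrite -natr1 -subr_ge0; set K := (size s)%:R.
have -> : (p * a + (1 - p) * b) ^+ 2 + (K + 1) * (p * (1 - p)) -
    (p * (a ^+ 2 + K * (p * (1 - p))) + (1 - p) * (b ^+ 2 + K * (p * (1 - p)))) =
    p * (1 - p) * (1 - (a - b) ^+ 2) by ring.
by rewrite !mulr_ge0 // subr_ge0.
Qed.

Lemma bernoulli_mean_dist_le p h : 0 <= p <= 1 -> unit_differences h ->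
  bernoulli_mean p (fun E => `|h E - bernoulli_mean p h|) ^+ 2 <=
  #|I|%:R * (p * (1 - p)).
Proof.
move=> p01 h1; set m := bernoulli_mean p h.
apply: le_trans (bernoulli_mean_sqr_le _ p01) _.
under eq_bernoulli_mean => E do rewrite real_normK ?num_real //.
have shift1 : unit_differences (fun E => h E - m).
  by move=> e E; rewrite opprB addrA subrK; exact: h1.
apply: le_trans (efron_stein p01 shift1) _.
by rewrite bernoulli_meanD bernoulli_mean_cst subrr expr0n add0r.
Qed.
End bernoulli.

(** * Expected numbers of components *)

Section component_counts.
Variable n : nat.
Implicit Types (E : {set edge n}) (S : {set 'I_n}) (k K : nat).

Definition ncomponents k E : nat := (\sum_(S in components E) (#|S| == k))%N.

Lemma sum_ncomponents (F : nat -> nat) K E :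
  (\sum_(0 <= k < K) F k * ncomponents k E =
   \sum_(S in components E) F #|S| * (#|S| < K))%N.
Proof.
under eq_bigr do rewrite big_distrr.
rewrite exchange_big /=; apply: eq_bigr => S _; rewrite big_mkord.
have [SK|KS] := ltnP #|S| K; last first.
  rewrite muln0 big1 // => k _; case: eqP => [Sk|]; rewrite ?muln0 //.
  by have := ltn_ord k; rewrite -Sk ltnNge KS.
rewrite (bigD1 (Ordinal SK)) //= eqxx big1 ?addn0 // => k kS.
by case: eqP => [Sk|]; rewrite ?muln0 //; case/eqP: kS; apply: val_inj.
Qed.

Lemma sum_ncomponents_le_kappa K E : (\sum_(0 <= k < K) ncomponents k E <= kappa E)%N.
Proof.
under eq_bigr do rewrite -[ncomponents _ _]mul1n.
rewrite (sum_ncomponents (fun=> 1%N)) /kappa -sum1_card.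
by apply: leq_sum => S _; rewrite mul1n leq_b1.
Qed.

Lemma sum_size_ncomponents_le K E : (\sum_(0 <= k < K) k * ncomponents k E <= n)%N.
Proof.
rewrite (sum_ncomponents id) -[X in (_ <= X)%N](sum_card_components E).
by apply: leq_sum => S _; rewrite -[X in (_ <= X)%N]muln1 leq_mul2l leq_b1 orbT.
Qed.

Lemma kappa_le_sum_ncomponents K E :
  (K * kappa E <= K * (\sum_(0 <= k < K) ncomponents k E) + n)%N.
Proof.
under eq_bigr do rewrite -[ncomponents _ _]mul1n.
rewrite (sum_ncomponents (fun=> 1%N)) -[X in (_ <= _ + X)%N](sum_card_components E).
rewrite /kappa -sum1_card !big_distrr -big_split /=; apply: leq_sum => S _.
by case: (ltnP #|S| K) => /= KS; lia.
Qed.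
End component_counts.

Section component_means.
Variables (R : realFieldType) (n : nat).
Implicit Types (A E : {set edge n}) (S : {set 'I_n}) (p : R).

Lemma kappa_unit_differences : unit_differences (fun E => (kappa E)%:R : R).
Proof.
move=> e E; set F := set_element e false E.
have -> : set_element e true E = e |: F.
  by rewrite -(set_element_set_element e true false).
have := kappa_subset (subsetUr [set e]%SET F); have := kappa_setU1_ge F e.
rewrite distrC -!(ler_nat R) -natr1 => kappa_ub kappa_lb.
by rewrite ger0_norm ?subr_ge0 // lerBlDl.
Qed.

Lemma bernoulli_mean_kappa_deviation p : 0 <= p <= 1 ->
  bernoulli_mean p (fun E : {set edge n} =>
    `|(kappa E)%:R - bernoulli_mean p (fun F : {set edge n} => (kappa F)%:R)|) ^+ 2 <=
  n%:R ^+ 2 * p.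
Proof.
move=> p01; have /andP[p0 p1] := p01.
apply: le_trans (bernoulli_mean_dist_le p01 kappa_unit_differences) _.
rewrite ler_pM ?mulr_ge0 ?subr_ge0 ?ler_piMr ?gerBl //.
by rewrite -natrX ler_nat expnS expn1 card_edge_le.
Qed.

Lemma bernoulli_mean_component_le p S : 0 <= p <= 1 ->
  bernoulli_mean p (fun E => (S \in components E)%:R) <=
  (ntrees #|S|)%:R * (p ^+ #|S|.-1 * (1 - p) ^+ (#|S| * (n - #|S|))).
Proof.
move=> p01; have /andP[p0 p1] := p01.
apply: (@le_trans _ _ (\sum_(A in trees_on S) bernoulli_mean p
    (fun E => ((A \subset E) && [disjoint cut S & E])%:R))).
  rewrite -bernoulli_mean_sum; apply: ler_bernoulli_mean => // E.
  have [/components_cut_tree[SE [A AS AE]]|_] := boolP (S \in components E); last first.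
    exact: sumr_ge0.
  by rewrite (bigD1 A) //= AE SE lerDl; apply: sumr_ge0.
rewrite -card_trees_on mulr_natl -sumr_const; apply: ler_sum => A /trees_onP[AS cA _].
rewrite bernoulli_mean_subset_disjoint; last first.
  by rewrite disjoints_subset /cut setCD subsetU // AS orbT.
by rewrite -cA ler_wpM2l ?exprn_ge0 // ler_wiXn2l ?subr_ge0 ?gerBl // cA card_cut_ge.
Qed.

Lemma bernoulli_mean_component_ge p S : 0 <= p <= 1 ->
  (ntrees #|S|)%:R * (p ^+ #|S|.-1 * (1 - p) ^+ (#|S| * n)) <=
  bernoulli_mean p (fun E => (S \in components E)%:R).
Proof.
move=> p01; have /andP[p0 p1] := p01.
apply: (@le_trans _ _ (\sum_(A in trees_on S)
    bernoulli_mean p (fun E => (E :&: edges_at S == A)%:R))).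
  rewrite -card_trees_on mulr_natl -sumr_const.
  apply: ler_sum => A /trees_onP[AS cA _].
  rewrite bernoulli_mean_setI; last exact: subset_trans AS (edges_in_subset_at S).
  rewrite -cA ler_wpM2l ?exprn_ge0 // ler_wiXn2l ?subr_ge0 ?gerBl // cA.
  by apply: leq_trans (card_edges_at_le S); exact/subset_leq_card/subsetDl.
rewrite -bernoulli_mean_sum; apply: ler_bernoulli_mean => // E.
have [SE|/negP SE] := boolP (S \in components E); last first.
  rewrite big1 // => A AS; case: eqP => // EA.
  by case: SE; exact: tree_component EA.
rewrite -natr_sum lern1 -big_mkcondr /= sum1dep_card.
rewrite -[leqRHS](cards1 (E :&: edges_at S)); apply/subset_leq_card/subsetP => A.
by rewrite !inE => /andP[_ /eqP ->].
Qed.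

Lemma bernoulli_mean_ncomponents p k :
  bernoulli_mean p (fun E => (ncomponents k E)%:R) =
  \sum_(S : {set 'I_n} | #|S| == k)
    bernoulli_mean p (fun E => (S \in components E)%:R).
Proof.
rewrite -bernoulli_mean_sum; apply: eq_bernoulli_mean => E; rewrite -natr_sum.
congr _%:R; rewrite /ncomponents big_mkcond [RHS]big_mkcond; apply: eq_bigr => S _.
by case: (S \in _); case: (_ == _).
Qed.

Lemma sum_sets_card k (x : R) : \sum_(S : {set 'I_n} | #|S| == k) x = 'C(n, k)%:R * x.
Proof.
rewrite sumr_const mulr_natl -[in RHS](card_ord n) -card_draws.
by congr (_ *+ _); apply: eq_card => S; rewrite !inE.
Qed.

Lemma bernoulli_mean_ncomponents_le p k : 0 <= p <= 1 ->
  bernoulli_mean p (fun E => (ncomponents k E)%:R) <=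
  'C(n, k)%:R * ((ntrees k)%:R * (p ^+ k.-1 * (1 - p) ^+ (k * (n - k)))).
Proof.
move=> p01; rewrite bernoulli_mean_ncomponents -sum_sets_card.
by apply: ler_sum => S /eqP <-; exact: bernoulli_mean_component_le.
Qed.

Lemma bernoulli_mean_ncomponents_ge p k : 0 <= p <= 1 ->
  'C(n, k)%:R * ((ntrees k)%:R * (p ^+ k.-1 * (1 - p) ^+ (k * n))) <=
  bernoulli_mean p (fun E => (ncomponents k E)%:R).
Proof.
move=> p01; rewrite bernoulli_mean_ncomponents -sum_sets_card.
by apply: ler_sum => S /eqP <-; exact: bernoulli_mean_component_ge.
Qed.

(* Union bound over the cuts [S] avoided by [E] with [#|S| <= n / 2]: the
   probability is at most [y ^+ #|S|], and the sum over all [S] is a binomial. *)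
Lemma bernoulli_mean_disconnected_le p (y : R) : 0 <= p <= 1 ->
  (forall m, (n <= m.*2)%N -> (1 - p) ^+ m <= y) ->
  bernoulli_mean p (fun E => (1 < kappa E)%N%:R) <= (1 + y) ^+ n - 1.
Proof.
move=> p01 y_ge; have /andP[p0 p1] := p01; have q0 : 0 <= 1 - p by rewrite subr_ge0.
have y0 : 0 <= y by apply: le_trans (y_ge n _); rewrite ?exprn_ge0 // -addnn leq_addr.
have -> : (1 + y) ^+ n - 1 = \sum_(S : {set 'I_n} | S != set0) y ^+ #|S|.
  rewrite [1 + y]addrC -[in LHS](card_ord n) -prodr_const bigA_distr (bigD1 set0) //=.
  rewrite [X in X + _ - 1]big1 => [|i]; last by rewrite inE.
  rewrite addrAC subrr add0r; apply: eq_bigr => S _.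
  by rewrite -big_mkcond prodr_const.
apply: (@le_trans _ _ (\sum_(S : {set 'I_n} | (S != set0) && (#|S|.*2 <= n)%N)
    bernoulli_mean p (fun E => ((set0 \subset E) && [disjoint cut S & E])%:R))).
  rewrite -bernoulli_mean_sum; apply: ler_bernoulli_mean => // E.
  have [/disconnected_cut[S [S0 Sn dS]]|_] := ltnP 1 (kappa E); last exact: sumr_ge0.
  by rewrite (bigD1 S) ?S0 //= sub0set dS lerDl; apply: sumr_ge0.
rewrite [leRHS](bigID (fun S : {set 'I_n} => (#|S|.*2 <= n)%N)) /= -[leLHS]addr0.
apply: lerD; last by apply: sumr_ge0 => S _; rewrite exprn_ge0.
apply: ler_sum => S /andP[S0 Sn].
rewrite bernoulli_mean_subset_disjoint ?disjoints_subset ?sub0set //.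
rewrite cards0 expr0 mul1r; apply: (@le_trans _ _ ((1 - p) ^+ (#|S| * (n - #|S|)))).
  by rewrite ler_wiXn2l ?gerBl // card_cut_ge.
rewrite mulnC exprM lerXn2r ?nnegrE ?exprn_ge0 //; apply: y_ge.
by move: Sn; move: #|S| => k; lia.
Qed.
End component_means.

From mathcomp Require Import all_classical all_reals all_analysis measurable_realfun.
Import numFieldNormedType.Exports.
Local Open Scope classical_set_scope.
Local Open Scope ring_scope.

(** * The limiting density of components *)

Section elementary_bounds.
Variable R : realType.
Implicit Types (c x : R) (k m n : nat).

Lemma ffact_le_expn m n : (n ^_ m <= n ^ m)%N.
Proof.
elim: m => [|m IH]; first by rewrite ffactn0.
by rewrite ffactnSr expnSr leq_mul // leq_subr.
Qed.

Lemma prodr_onem_ge (I : Type) (s : seq I) (x : I -> R) :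
  (forall i, 0 <= x i <= 1) -> 1 - \sum_(i <- s) x i <= \prod_(i <- s) (1 - x i).
Proof.
move=> x01; elim: s => [|i s IH]; first by rewrite !big_nil subr0.
rewrite !big_cons; have /andP[xi0 xi1] := x01 i.
have s0 : 0 <= \sum_(j <- s) x j by apply: sumr_ge0 => j _; case/andP: (x01 j).
have xi1' : 0 <= 1 - x i by rewrite subr_ge0.
apply: le_trans (ler_wpM2l xi1' IH); have := mulr_ge0 xi0 s0; lra.
Qed.

Lemma exprn_onem_ge x m : 0 <= x <= 1 -> 1 - m%:R * x <= (1 - x) ^+ m.
Proof.
move=> x01; have := @prodr_onem_ge _ (index_iota 0 m) (fun=> x) (fun=> x01).
by rewrite !big_const_nat !subn0 iter_addr_0 iter_mulr_1 mulr_natl.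
Qed.

Lemma ffact_ge_exprn k n :
  n%:R ^+ k * (1 - k%:R ^+ 2 / n%:R) <= (n ^_ k)%:R :> R.
Proof.
case: n => [|n].
  case: k => [|k]; first by rewrite ffactn0 expr0 invr0 mulr0 subr0 mulr1.
  by rewrite expr0n mul0r.
have n0 : 0 < n.+1%:R :> R by [].
have [nk|kn] := ltnP n.+1 k.
  rewrite ffact_small // pmulr_rle0 ?exprn_gt0 // subr_le0 ler_pdivlMr // mul1r.
  by rewrite -natrX ler_nat (leq_trans (ltnW nk)) // leq_pmull // (leq_trans _ nk).
rewrite ffact_prod natr_prod.
have -> : \prod_(i < k) (n.+1 - i)%:R =
    n.+1%:R ^+ k * \prod_(i < k) (1 - i%:R / n.+1%:R) :> R.
  rewrite -[in X in _ = X * _](card_ord k) -prodr_const -big_split /=.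
  apply: eq_bigr => i _; rewrite natrB ?(ltnW (leq_trans _ kn)) //.
  by field; rewrite gt_eqF.
rewrite ler_wpM2l ?exprn_ge0 //.
have iN (i : 'I_k) : 0 <= (i%:R / n.+1%:R : R) <= 1.
  by rewrite divr_ge0 //= ler_pdivrMr // mul1r ler_nat ltnW ?(leq_trans _ kn).
apply: le_trans (prodr_onem_ge _ iN); rewrite lerD2l lerN2 -mulr_suml.
rewrite ler_wpM2r ?invr_ge0 // -natr_sum -natrX ler_nat.
apply: (@leq_trans (\sum_(i < k) k)); first by apply: leq_sum => i _; exact: ltnW.
by rewrite sum_nat_const card_ord expnS expn1.
Qed.

Lemma exprn_onem_le_expR x m : x <= 1 -> (1 - x) ^+ m <= expR (- (m%:R * x)).
Proof.
move=> x1; rewrite -mulrN expRM_natl lerXn2r ?nnegrE ?expR_ge0 ?subr_ge0 //.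
exact: expR_ge1Dx.
Qed.

Lemma exprn_onem_ge_expR x m : 0 <= x <= 1 ->
  expR (- (m%:R * x)) * (1 - m%:R * x ^+ 2) <= (1 - x) ^+ m.
Proof.
move=> /andP[x0 x1].
have x2 : 0 <= x ^+ 2 <= 1 by rewrite exprn_ge0 //= exprn_ile1.
apply: le_trans (ler_wpM2l (expR_ge0 _) (exprn_onem_ge m x2)) _.
have /andP[_ x21] := x2; rewrite -mulrN expRM_natl -exprMn.
rewrite lerXn2r ?nnegrE ?mulr_ge0 ?expR_ge0 ?subr_ge0 //.
have -> : 1 - x ^+ 2 = (1 - x) * (1 + x) by ring.
rewrite mulrCA ler_piMr ?subr_ge0 // expRN mulrC ler_pdivrMr ?expR_gt0 // mul1r.
exact: expR_ge1Dx.
Qed.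
End elementary_bounds.

Section component_density.
Variable R : realType.
Implicit Types (c : R) (n k K : nat).

Definition component_density k c : R :=
  (ntrees k)%:R * c ^+ k.-1 * expR (- (k%:R * c)) / k`!%:R.

Definition kappa_density c : R := limn (series (component_density ^~ c)).

Definition mean_ncomponents n k c : R :=
  bernoulli_mean (c / n%:R) (fun E : {set edge n} => (ncomponents k E)%:R) / n%:R.

Definition mean_kappa n c : R :=
  bernoulli_mean (c / n%:R) (fun E : {set edge n} => (kappa E)%:R) / n%:R.

Lemma component_density0 c : component_density 0 c = 0.
Proof. by rewrite /component_density ntrees0 !mul0r. Qed.

Lemma component_density_ge0 k c : 0 <= c -> 0 <= component_density k c.
Proof. by move=> c0; rewrite !mulr_ge0 ?expR_ge0 ?invr_ge0 ?exprn_ge0. Qed.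

Lemma divrn_itv01 n c : 0 <= c <= n%:R -> 0 <= c / n%:R <= 1.
Proof.
case: n => [|n] /andP[c0 cn]; first by rewrite invr0 mulr0 lexx ler01.
by rewrite divr_ge0 //= ler_pdivrMr // mul1r.
Qed.

Lemma mean_ncomponents_ge0 n k c : 0 <= c <= n%:R -> 0 <= mean_ncomponents n k c.
Proof.
by move=> cn; rewrite divr_ge0 // bernoulli_mean_ge0 // divrn_itv01.
Qed.

Lemma binomial_tree_count n k c (t w : R) : (0 < n)%N ->
  'C(n, k.+1)%:R * (t * ((c / n%:R) ^+ k * w)) / n%:R =
  (n ^_ k.+1)%:R / n%:R ^+ k.+1 * (t * c ^+ k * w / k.+1`!%:R).
Proof.
move=> n0; rewrite -bin_ffact natrM exprMn exprVn exprS; field.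
by rewrite !gt_eqF ?exprn_gt0 ?ltr0n ?fact_gt0.
Qed.

Lemma mean_ncomponents_le n k c : (0 < n)%N -> 0 <= c <= n%:R ->
  mean_ncomponents n k c * (1 - c / n%:R * k%:R ^+ 2) <= component_density k c.
Proof.
move=> n0 cn; have n0R : 0 < n%:R :> R by rewrite ltr0n.
have /andP[c0 _] := cn; have p01 := divrn_itv01 cn; have /andP[p0 p1] := p01.
set x := c / n%:R * k%:R ^+ 2.
suff : mean_ncomponents n k c <= component_density k c * expR x.
  move=> m_le; apply: le_trans (ler_wpM2l (mean_ncomponents_ge0 k cn) (expR_ge1Dx (- x))) _.
  by rewrite expRN ler_pdivrMr ?expR_gt0.
have := bernoulli_mean_ncomponents_le n k p01.
rewrite -(ler_pM2r (_ : 0 < n%:R^-1)) ?invr_gt0 // => /le_trans; apply.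
case: k @x => [|k] x; first by rewrite component_density0 ntrees0 !(mul0r, mulr0).
have [nk|kn] := ltnP n k.+1.
  by rewrite bin_small // !mul0r mulr_ge0 ?expR_ge0 ?component_density_ge0.
rewrite binomial_tree_count //; apply: le_trans (ler_piMl _ _) _.
- by rewrite !mulr_ge0 ?invr_ge0 ?exprn_ge0 ?subr_ge0.
- by rewrite ler_pdivrMr ?exprn_gt0 // mul1r -natrX ler_nat ffact_le_expn.
rewrite /component_density [leRHS]mulrAC ler_wpM2r ?invr_ge0 // -[leRHS]mulrA.
rewrite ler_wpM2l ?mulr_ge0 ?exprn_ge0 // -expRD.
apply: le_trans (exprn_onem_le_expR _ p1) _; rewrite ler_expR natrM natrB //.
by rewrite /x le_eqVlt; apply/orP; left; apply/eqP; field; rewrite gt_eqF.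
Qed.

Lemma mean_ncomponents_ge n k c : (0 < n)%N -> 0 <= c <= n%:R ->
  component_density k c * (1 - (1 + c ^+ 2) / n%:R * k%:R ^+ 2) <= mean_ncomponents n k c.
Proof.
move=> n0 cn; have n0R : 0 < n%:R :> R by rewrite ltr0n.
have /andP[c0 _] := cn; have p01 := divrn_itv01 cn; have /andP[p0 p1] := p01.
have [neg|pos] := leP (1 - (1 + c ^+ 2) / n%:R * k%:R ^+ 2) 0.
  apply: le_trans (mean_ncomponents_ge0 k cn).
  by rewrite mulr_ge0_le0 ?component_density_ge0.
have := bernoulli_mean_ncomponents_ge n k p01.
rewrite -(ler_pM2r (_ : 0 < n%:R^-1)) ?invr_gt0 //; apply: le_trans.
case: k pos => [|k] pos; first by rewrite component_density0 ntrees0 !(mul0r, mulr0).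
rewrite binomial_tree_count //.
set a := k.+1%:R ^+ 2 / n%:R : R; set b := k.+1%:R * c ^+ 2 / n%:R.
have a0 : 0 <= a by rewrite divr_ge0 ?exprn_ge0.
have b0 : 0 <= b by rewrite divr_ge0 ?mulr_ge0 ?exprn_ge0.
have ab : 1 - (1 + c ^+ 2) / n%:R * k.+1%:R ^+ 2 <= 1 - a - b.
  rewrite -addrA -opprD lerD2l lerN2.
  have -> : (1 + c ^+ 2) / n%:R * k.+1%:R ^+ 2 = a + k.+1%:R * b by rewrite /a /b; ring.
  by rewrite lerD2l ler_peMl // ler1n.
have fall : 1 - a <= (n ^_ k.+1)%:R / n%:R ^+ k.+1.
  by rewrite ler_pdivlMr ?exprn_gt0 // mulrC ffact_ge_exprn.
have noEdge : expR (- (k.+1%:R * c)) * (1 - b) <= (1 - c / n%:R) ^+ (k.+1 * n).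
  have := exprn_onem_ge_expR (k.+1 * n) p01; rewrite natrM.
  have -> : k.+1%:R * n%:R * (c / n%:R) = k.+1%:R * c by field; rewrite gt_eqF.
  by have -> : k.+1%:R * n%:R * (c / n%:R) ^+ 2 = b by rewrite /b; field; rewrite gt_eqF.
have a1 : 0 <= 1 - a by lra.
apply: le_trans (ler_wpM2l (component_density_ge0 _ c0) ab) _.
apply: (@le_trans _ _ ((1 - a) * (component_density k.+1 c * (1 - b)))).
  rewrite mulrCA ler_wpM2l ?component_density_ge0 //; have := mulr_ge0 a0 b0; lra.
apply: ler_pM => //; first by rewrite mulr_ge0 ?component_density_ge0 //; lra.
rewrite /component_density [leLHS]mulrAC ler_wpM2r ?invr_ge0 // -[leLHS]mulrA.
by rewrite ler_wpM2l ?mulr_ge0 ?exprn_ge0.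
Qed.

Lemma sum_size_mean_ncomponents_le n K c : (0 < n)%N -> 0 <= c <= n%:R ->
  \sum_(0 <= k < K) k%:R * mean_ncomponents n k c <= 1.
Proof.
move=> n0 cn; have n0R : 0 < n%:R :> R by rewrite ltr0n.
under eq_bigr do rewrite mulrA -bernoulli_meanZ.
rewrite -mulr_suml -bernoulli_mean_sum ler_pdivrMr // mul1r.
rewrite -[leRHS](@bernoulli_mean_cst _ (edge n) (c / n%:R)).
apply: ler_bernoulli_mean => [|E]; first exact: divrn_itv01.
under eq_bigr do rewrite -natrM.
by rewrite -natr_sum ler_nat sum_size_ncomponents_le.
Qed.

Lemma mean_kappa_bounds n K c : (0 < n)%N -> (0 < K)%N -> 0 <= c <= n%:R ->
  \sum_(0 <= k < K) mean_ncomponents n k c <= mean_kappa n c <=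
  \sum_(0 <= k < K) mean_ncomponents n k c + K%:R^-1.
Proof.
move=> n0 K0 cn; have n0R : 0 < n%:R :> R by rewrite ltr0n.
have K0R : 0 < K%:R :> R by rewrite ltr0n.
have p01 := divrn_itv01 cn.
rewrite /mean_kappa /mean_ncomponents -mulr_suml -bernoulli_mean_sum.
have -> : K%:R^-1 = bernoulli_mean (c / n%:R) (fun E : {set edge n} => n%:R / K%:R) / n%:R.
  by rewrite bernoulli_mean_cst; field; rewrite !gt_eqF.
rewrite -mulrDl -bernoulli_meanD !ler_pM2r ?invr_gt0 //.
apply/andP; split; apply: ler_bernoulli_mean => // E.
  by rewrite -natr_sum ler_nat sum_ncomponents_le_kappa.
rewrite -(ler_pM2l K0R) mulrDr mulrCA divff ?gt_eqF // mulr1.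
by rewrite -natr_sum -!natrM -natrD ler_nat kappa_le_sum_ncomponents.
Qed.

Lemma sum_size_component_density_le K c : 0 <= c ->
  \sum_(0 <= k < K) k%:R * component_density k c <= 1.
Proof.
move=> c0; apply/ler_addgt0Pr => eps eps0.
pose D := \sum_(0 <= k < K) k%:R * component_density k c * ((1 + c ^+ 2) * k%:R ^+ 2).
near \oo => n.
have n0 : (0 < n)%N by near: n; exists 1%N.
have n0R : 0 < n%:R :> R by rewrite ltr0n.
have cn : 0 <= c <= n%:R by rewrite c0; near: n; exact: nbhs_infty_ger.
have Dn : D / n%:R <= eps.
  by rewrite ler_pdivrMr // mulrC -ler_pdivrMr //; near: n; exact: nbhs_infty_ger.
rewrite -lerBlDr; apply: le_trans (lerB (lexx _) Dn) _.
apply: le_trans (sum_size_mean_ncomponents_le K n0 cn).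
rewrite /D mulr_suml -sumrB; apply: ler_sum => k _.
have := ler_wpM2l (ler0n R k) (mean_ncomponents_ge k n0 cn); apply: le_trans.
by rewrite le_eqVlt; apply/orP; left; apply/eqP; ring.
Unshelve. all: by end_near. Qed.

Lemma nondecreasing_series_component_density c : 0 <= c ->
  nondecreasing_seq (series (component_density ^~ c)).
Proof.
by move=> c0; apply: nondecreasing_series => k _ _; exact: component_density_ge0.
Qed.

Lemma series_component_density_le K m c : (0 < K)%N -> 0 <= c ->
  series (component_density ^~ c) m <= series (component_density ^~ c) K + K%:R^-1.
Proof.
move=> K0 c0; have K0R : 0 < K%:R :> R by rewrite ltr0n.
have [mK|/ltnW Km] := leqP m K.
  apply: (le_trans (nondecreasing_series_component_density c0 mK)).
  by rewrite lerDl invr_ge0.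
rewrite addrC -lerBlDr sub_series_geq // -(ler_pM2l K0R) divff ?gt_eqF // mulr_sumr.
apply: le_trans (sum_size_component_density_le m c0).
rewrite [leRHS](big_cat_nat (leq0n K) Km) /= -[leLHS]add0r; apply: lerD.
  by apply: sumr_ge0 => k _; rewrite mulr_ge0 ?component_density_ge0.
by apply: ler_sum_nat => k /andP[Kk _]; rewrite ler_wpM2r ?component_density_ge0 ?ler_nat.
Qed.

Lemma cvg_series_component_density c : 0 <= c ->
  series (component_density ^~ c) @ \oo --> kappa_density c.
Proof.
move=> c0; apply: nondecreasing_is_cvgn (nondecreasing_series_component_density c0) _.
exists (series (component_density ^~ c) 1 + 1%:R^-1) => _ [m _ <-].
exact: series_component_density_le.
Qed.

Lemma kappa_density_bounds K c : (0 < K)%N -> 0 <= c ->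
  series (component_density ^~ c) K <= kappa_density c <=
  series (component_density ^~ c) K + K%:R^-1.
Proof.
move=> K0 c0; have cvg := cvg_series_component_density c0; apply/andP; split.
  apply: nondecreasing_cvgn_le; first exact: nondecreasing_series_component_density.
  exact: cvgP cvg.
apply: cvgr_to_le cvg _; near=> m; exact: series_component_density_le.
Unshelve. all: by end_near. Qed.

Lemma kappa_density_itv01 c : 0 <= c -> 0 <= kappa_density c <= 1.
Proof.
move=> c0; have := kappa_density_bounds (ltn0Sn 0) c0.
by rewrite /series /= big_nat1 component_density0 add0r invr1.
Qed.

Lemma sum_le_size_weighted K (u v : nat -> R) (d : R) : 0 <= d ->
  (forall k, 0 <= u k) -> \sum_(0 <= k < K.+1) k%:R * u k <= 1 ->
  (forall k, u k * (1 - d * k%:R ^+ 2) <= v k) ->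
  \sum_(0 <= k < K.+1) u k <= \sum_(0 <= k < K.+1) v k + d * K%:R.
Proof.
move=> d0 u0 u1 uv; rewrite addrC -lerBlDr -sumrB.
apply: (@le_trans _ _ (d * K%:R * \sum_(0 <= k < K.+1) k%:R * u k)); last first.
  by rewrite ler_piMr ?mulr_ge0.
rewrite mulr_sumr; apply: ler_sum_nat => k /andP[_]; rewrite ltnS => kK.
have {uv} := uv k; rewrite mulrBr mulr1 lerBlDr -lerBlDl => /le_trans; apply.
rewrite (_ : u k * (d * _) = d * (k%:R * u k) * k%:R); last by ring.
rewrite (_ : d * K%:R * _ = d * (k%:R * u k) * K%:R); last by ring.
by rewrite ler_wpM2l ?mulr_ge0 // ler_nat.
Qed.

Lemma mean_kappa_density_truncation n K c : (0 < n)%N -> 0 <= c <= n%:R ->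
  `|mean_kappa n c - kappa_density c| <= (1 + c) ^+ 2 / n%:R * K%:R + K.+1%:R^-1.
Proof.
move=> n0 cn; have /andP[c0 _] := cn; have n0R : 0 < n%:R :> R by rewrite ltr0n.
have /andP[mean_lb mean_ub] := mean_kappa_bounds n0 (ltn0Sn K) cn.
have /andP[dens_lb dens_ub] := kappa_density_bounds (ltn0Sn K) c0.
have mean_dens := sum_le_size_weighted (divr_ge0 c0 (ltW n0R))
  (fun k => mean_ncomponents_ge0 k cn) (sum_size_mean_ncomponents_le K.+1 n0 cn)
  (fun k => mean_ncomponents_le k n0 cn).
have c21 : 0 <= 1 + c ^+ 2 by rewrite addr_ge0 ?exprn_ge0.
have dens_mean := sum_le_size_weighted (divr_ge0 c21 (ltW n0R))
  (fun k => component_density_ge0 k c0) (sum_size_component_density_le K.+1 c0)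
  (fun k => mean_ncomponents_ge k n0 cn).
have weight_le (x : R) : x <= (1 + c) ^+ 2 -> x / n%:R * K%:R <= (1 + c) ^+ 2 / n%:R * K%:R.
  by move=> xc; rewrite !ler_wpM2r ?invr_ge0.
have /weight_le c_le : c <= (1 + c) ^+ 2.
  by rewrite sqrrD expr1n mul1r; have := sqr_ge0 c; lra.
have /weight_le c2_le : 1 + c ^+ 2 <= (1 + c) ^+ 2.
  by rewrite sqrrD expr1n mul1r lerD2r lerDl mulrn_wge0.
rewrite /series /= in dens_lb dens_ub.
have := le_trans mean_dens (lerD (lexx _) c_le).
have := le_trans dens_mean (lerD (lexx _) c2_le).
move: mean_lb mean_ub dens_lb dens_ub; clear.
set err := (1 + c) ^+ 2 / _ * _; set tail := _^-1.
by rewrite ler_norml => *; apply/andP; split; lra.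
Qed.

Lemma mean_kappa_density_dist n c : (0 < n)%N -> 0 <= c <= n%:R ->
  `|mean_kappa n c - kappa_density c| <= 2 * (1 + c) / Num.sqrt n%:R.
Proof.
move=> n0 cn; have /andP[c0 _] := cn; have n0R : 0 < n%:R :> R by rewrite ltr0n.
set s := Num.sqrt n%:R; have s0 : 0 < s by rewrite sqrtr_gt0.
have sn : s ^+ 2 = n%:R by rewrite sqr_sqrtr // ltW.
have c1 : 0 < 1 + c by rewrite ltr_wpDr.
pose r := s / (1 + c); have r0 : 0 < r by rewrite divr_gt0.
have /andP[Kr rK] := truncn_itv (ltW r0).
apply: le_trans (mean_kappa_density_truncation (Num.truncn r) n0 cn) _.
have -> : 2 * (1 + c) / s = (1 + c) ^+ 2 / n%:R * r + r^-1.
  by rewrite -sn /r; field; rewrite !gt_eqF.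
apply: lerD; first by rewrite ler_wpM2l // divr_ge0 ?exprn_ge0 // ltW.
by rewrite lef_pV2 ?posrE ?ltr0n // ltW.
Qed.

Lemma bernoulli_mean_kappa_dist n c : (0 < n)%N -> 0 <= c <= n%:R ->
  bernoulli_mean (c / n%:R)
    (fun E : {set edge n} => `|(kappa E)%:R / n%:R - kappa_density c|) <=
  3 * (1 + c) / Num.sqrt n%:R.
Proof.
move=> n0 cn; have /andP[c0 _] := cn; have n0R : 0 < n%:R :> R by rewrite ltr0n.
set s := Num.sqrt n%:R; have s0 : 0 < s by rewrite sqrtr_gt0.
have sn : s ^+ 2 = n%:R by rewrite sqr_sqrtr // ltW.
have p01 := divrn_itv01 cn; pose K (E : {set edge n}) : R := (kappa E)%:R.
pose m := bernoulli_mean (c / n%:R) K.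
have dev_le : bernoulli_mean (c / n%:R) (fun E => `|K E - m|) <= (1 + c) * s.
  rewrite -ler_sqr ?nnegrE ?mulr_ge0 ?addr_ge0 ?(ltW s0) ?bernoulli_mean_ge0 //.
  apply: le_trans (bernoulli_mean_kappa_deviation n p01) _; rewrite exprMn sn.
  rewrite [leLHS](_ : _ = c * n%:R); last by field; rewrite gt_eqF.
  by rewrite ler_wpM2r //; nra.
apply: (@le_trans _ _ (bernoulli_mean (c / n%:R) (fun E =>
    n%:R^-1 * `|K E - m| + `|mean_kappa n c - kappa_density c|))).
  apply: ler_bernoulli_mean => // E; rewrite -/(K E).
  have -> : K E / n%:R - kappa_density c =
      n%:R^-1 * (K E - m) + (mean_kappa n c - kappa_density c).
    by rewrite /mean_kappa -/m; ring.
  by apply: le_trans (ler_normD _ _) _; rewrite normrM gtr0_norm ?invr_gt0.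
rewrite bernoulli_meanD bernoulli_meanZ bernoulli_mean_cst.
have -> : 3 * (1 + c) / s = n%:R^-1 * ((1 + c) * s) + 2 * (1 + c) / s.
  by rewrite -sn; field; rewrite gt_eqF.
by apply: lerD; [rewrite ler_pM2l ?invr_gt0 | exact: mean_kappa_density_dist].
Qed.

Lemma kappa_density_ge_expR c : 0 <= c -> expR (- c) <= kappa_density c.
Proof.
move=> c0; have /andP[lb _] := kappa_density_bounds (ltn0Sn 1) c0; apply: le_trans lb.
rewrite /series /= big_nat_recr //= big_nat1 component_density0 add0r.
by rewrite /component_density /= mulr1 mul1r divr1 ler_peMl ?expR_ge0 // ler1n ntrees1_gt0.
Qed.

(* [component_density k c] is [2 ^ (k - 1) * exp (- k c / 2)] times its value at
   [c / 2], and the first factor is at most [exp (- c / 2)] because [2 <= e]. *)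
Lemma component_density_half k c : 2 <= c ->
  component_density k c <= expR (- (c / 2)) * component_density k (c / 2).
Proof.
move=> c2; have c20 : 0 <= c / 2 by lra.
case: k => [|k]; first by rewrite !component_density0 mulr0.
have two_le : 2 * expR (- (c / 2)) <= 1.
  rewrite expRN ler_pdivrMr ?expR_gt0 // mul1r; apply: le_trans (expR_ge1Dx _).
  by lra.
have e0 : 0 <= 2 * expR (- (c / 2)) by rewrite mulr_ge0 ?expR_ge0.
have -> : component_density k.+1 c = (2 * expR (- (c / 2))) ^+ k *
    (expR (- (c / 2)) * component_density k.+1 (c / 2)).
  rewrite /component_density /= {1 2}(_ : c = 2 * (c / 2)); last by lra.
  rewrite -!mulrN mulrCA mulrN !expRM_natl !exprMn !exprS; ring.
by rewrite ler_piMl ?exprn_ile1 // mulr_ge0 ?expR_ge0 ?component_density_ge0.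
Qed.

Lemma kappa_density_le_expR c : 0 <= c -> kappa_density c <= expR (1 - c / 2).
Proof.
move=> c0; have c20 : 0 <= c / 2 by rewrite divr_ge0.
have [c2|/ltW c2] := leP c 2.
  have /andP[_ /le_trans] := kappa_density_itv01 c0; apply.
  by rewrite -[leLHS]expR0 ler_expR; lra.
apply: (@le_trans _ _ (expR (- (c / 2)))); last by rewrite ler_expR; lra.
apply: cvgr_to_le (cvg_series_component_density c0) _; near=> m.
apply: (@le_trans _ _ (expR (- (c / 2)) * series (component_density ^~ (c / 2)) m)).
  by rewrite /series /= mulr_sumr; apply: ler_sum => k _; exact: component_density_half.
rewrite ler_piMr ?expR_ge0 //; have := series_component_density_le m (ltn0Sn 0) c20.
by rewrite {2}/series /= big_nat1 component_density0 add0r invr1.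
Unshelve. all: by end_near. Qed.
End component_density.

(** * The limit constant *)

Section powR_bounds.
Variable R : realType.
Implicit Types p x : R.

Lemma powR_le_expR p x : 0 < p -> 0 <= x -> x `^ p <= p `^ p * expR x.
Proof.
move=> p0 x0; have xp0 : 0 <= x / p by rewrite divr_ge0 // ltW.
have xE : x = p * (x / p) by rewrite mulrC divfK ?gt_eqF.
rewrite {1}xE powRM ?(ltW p0) // ler_wpM2l ?powR_ge0 //.
rewrite [in leRHS]xE [X in expR X]mulrC expRM ge0_ler_powR ?nnegrE ?expR_ge0 ?(ltW p0) //.
by apply: le_trans (expR_ge1Dx _); rewrite lerDr.
Qed.

Lemma expRN_le_powR p x : 0 < p -> 0 < x -> expR (- x) <= p `^ p * x `^ (- p).
Proof.
move=> p0 x0; rewrite expRN powRN ler_pdivlMr ?powR_gt0 // mulrC ler_pdivrMr ?expR_gt0 //.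
exact: powR_le_expR (ltW x0).
Qed.

Lemma expRN_half_le_powR p x : 0 < p -> 0 < x ->
  expR (- (x / 2)) <= (2 * p) `^ p * x `^ (- p).
Proof.
move=> p0 x0; apply: le_trans (expRN_le_powR p0 (divr_gt0 x0 (ltr0n _ 2))) _.
have -> : (x / 2) `^ (- p) = 2 `^ p * x `^ (- p).
  by rewrite mulrC powRM ?invr_ge0 ?(ltW x0) // -powR_inv1 // -powRrM mulN1r opprK.
by rewrite [in leRHS]powRM ?(ltW p0) // mulrCA mulrA.
Qed.

Lemma powRN_cvgy p : 0 < p -> x `^ (- p) @[x --> +oo] --> (0 : R).
Proof.
move=> p0; apply/cvgr0Pnorm_le => e e0; near=> x.
have x0 : 0 < x by near: x; exact: nbhs_pinfty_gt.
rewrite ger0_norm ?powR_ge0 // powRN invf_ple ?posrE ?powR_gt0 //.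
have -> : e^-1 = (e^-1 `^ p^-1) `^ p.
  by rewrite -powRrM mulVf ?gt_eqF // powRr1 // invr_ge0 ltW.
by apply: ge0_ler_powR; rewrite ?nnegrE ?powR_ge0 ?(ltW p0) ?(ltW x0).
Unshelve. all: by end_near. Qed.

Lemma powRN_cvgn p : 0 < p -> n%:R `^ (- p) @[n --> \oo] --> (0 : R).
Proof. by move=> p0; apply: cvg_comp (@cvgr_idn R) (powRN_cvgy p0). Qed.

Lemma integral_powRN p a : 0 < p -> 0 < a ->
  (\int[lebesgue_measure]_(x in `[a, +oo[) (x `^ (- (p + 1)))%:E = (a `^ (- p) / p)%:E)%E.
Proof.
move=> p0 a0; pose F (x : R) := - (p^-1 * x `^ (- p)).
have dF (x : R) : 0 < x -> is_derive x 1 F (x `^ (- (p + 1))).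
  move=> x0; have := is_derive1_powR (- p) x0.
  move=> dpow; apply: is_derive_eq; rewrite opprD /GRing.scale /= !mulrA.
  by rewrite -mulNr mulrN mulVf ?gt_eqF // opprK mul1r.
rewrite (@ge0_continuous_FTC2y _ _ F a 0).
- by rewrite add0e -EFinN /F opprK mulrC.
- by move=> x _; exact: powR_ge0.
- apply: continuous_in_subspaceT => x; rewrite inE /= in_itv /= andbT => ax.
  apply: differentiable_continuous; apply/derivable1_diffP.
  by apply: derivable_powR; rewrite in_itv /= andbT (lt_le_trans a0).
- rewrite -oppr0 -[X in - X](mulr0 p^-1); apply: cvgN.
  by apply: cvgMr; exact: powRN_cvgy.
- by move=> x ax; have := dF x (lt_trans a0 ax) => ?; exact: ex_derive.
- apply: cvg_at_right_filter; apply: differentiable_continuous; apply/derivable1_diffP.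
  by have := dF a a0 => ?; exact: ex_derive.
- move=> x; rewrite in_itv /= andbT => ax; rewrite derive1E.
  by have := dF x (lt_trans a0 ax) => ?; rewrite derive_val.
Qed.
End powR_bounds.

Section integral_facts.
Variable R : realType.
Local Notation mu := (@lebesgue_measure R).

Lemma integral_itv_cst (a b r : R) : a <= b ->
  (\int[mu]_(x in `[a, b[) r%:E = (r * (b - a))%:E)%E.
Proof.
move=> ab; rewrite integral_cst //= lebesgue_measure_itv /= lte_fin.
case: ltP => [_|ba]; first by rewrite -EFinD -EFinM.
by have -> : a = b by [apply/le_anti; rewrite ab]; rewrite subrr mulr0 mule0.
Qed.

Lemma ge0_integral_itvy_split (f : R -> \bar R) (a b : R) : a <= b ->
  measurable_fun `[a, +oo[ f -> (forall x, a <= x -> (0 <= f x)%E) ->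
  (\int[mu]_(x in `[a, +oo[) f x =
   \int[mu]_(x in `[a, b[) f x + \int[mu]_(x in `[b, +oo[) f x)%E.
Proof.
move=> ab mf f0.
have aby : `[a, +oo[%classic = `[a, b[ `|` `[b, +oo[.
  by apply: itv_bndbnd_setU; rewrite bnd_simp.
rewrite {1}aby ge0_integral_setU -?aby // => [x|].
  by rewrite /= in_itv /= andbT => /f0.
apply/disj_setPS => x [] /=; rewrite !in_itv /= andbT => /andP[_ xb].
by rewrite leNgt xb.
Qed.

Lemma ge0_integral_dist d (T : measurableType d) (m : {measure set T -> \bar R})
    (D : set T) (f g : T -> R) : measurable D ->
  measurable_fun D f -> measurable_fun D g ->
  (forall x, D x -> 0 <= f x) -> (forall x, D x -> 0 <= g x) ->
  (\int[m]_(x in D) (f x)%:E <=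
   \int[m]_(x in D) `|f x - g x|%:E + \int[m]_(x in D) (g x)%:E)%E.
Proof.
move=> mD mf mg f0 g0.
have mfg : measurable_fun D (fun x => `|f x - g x|).
  by apply: measurableT_comp => //; exact: measurable_funB.
rewrite -ge0_integralD //; [|by apply/measurable_EFinP..].
apply: ge0_le_integral => //.
- by apply/measurable_EFinP.
- by apply: emeasurable_funD; apply/measurable_EFinP.
- by move=> x _; rewrite -EFinD lee_fin -lerBlDr ler_norm.
Qed.
End integral_facts.

Section kappa_profile.
Variables (R : realType) (q : R).
Hypothesis q_gt0 : 0 < q.
Local Notation mu := (@lebesgue_measure R).

Definition kappa_profile (s : R) : R := kappa_density (s `^ q).

Lemma kappa_profile_ge0 s : 0 <= kappa_profile s.
Proof. by case/andP: (kappa_density_itv01 (powR_ge0 s q)). Qed.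

Lemma kappa_profile_le1 s : kappa_profile s <= 1.
Proof. by case/andP: (kappa_density_itv01 (powR_ge0 s q)). Qed.

Lemma measurable_kappa_profile : measurable_fun setT kappa_profile.
Proof.
apply: measurable_fun_cvg => [m|s _]; last first.
  exact: cvg_series_component_density (powR_ge0 s q).
apply: measurable_sum => k; apply: measurable_funM => //.
apply: measurable_funM.
  by apply: measurable_funM => //; apply: measurable_funX; exact: measurable_powR.
apply: measurableT_comp => //; apply: measurable_funN.
by apply: measurable_funM => //; exact: measurable_powR.
Qed.

Let measurable_EFin_profile (D : set R) :
  measurable_fun D (fun s => (kappa_profile s)%:E).
Proof.
apply/measurable_EFinP; apply: measurable_funTS; exact: measurable_kappa_profile.
Qed.

Let EFin_profile_ge0 s : (0 <= (kappa_profile s)%:E)%E.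
Proof. by rewrite lee_fin kappa_profile_ge0. Qed.

Lemma kappa_profile_le_powR r : 0 < r -> exists2 C : R, 0 <= C &
  forall s, 0 < s -> kappa_profile s <= C * s `^ (- (r + 1)).
Proof.
move=> r0; pose p := (r + 1) / q.
have p0 : 0 < p by rewrite divr_gt0 // addr_gt0.
exists (expR 1 * (2 * p) `^ p) => [|s s0]; first by rewrite mulr_ge0 ?powR_ge0 ?expR_ge0.
apply: le_trans (kappa_density_le_expR (powR_ge0 _ _)) _.
rewrite expRD -mulrA ler_wpM2l ?expR_ge0 //.
apply: le_trans (expRN_half_le_powR p0 (powR_gt0 q s0)) _.
by rewrite -powRrM mulrN /p [q * _]mulrC divfK ?gt_eqF.
Qed.

Lemma integral_kappa_profile_tail r : 0 < r -> exists2 C : R, 0 <= C &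
  forall J : R, 0 < J ->
  (\int[mu]_(s in `[J, +oo[) (kappa_profile s)%:E <= (C * J `^ (- r))%:E)%E.
Proof.
move=> r0; have [C C0 profile_le] := kappa_profile_le_powR r0.
have mpow (D : set R) : measurable_fun D (fun s => (s `^ (- (r + 1)))%:E).
  by apply/measurable_EFinP; apply: measurable_funTS; exact: measurable_powR.
exists (C / r) => [|J J0]; first by rewrite divr_ge0 // ltW.
rewrite -mulrA [r^-1 * _]mulrC EFinM -integral_powRN // -ge0_integralZl_EFin //; last 2 first.
- by move=> s _; rewrite lee_fin powR_ge0.
- exact: mpow.
apply: ge0_le_integral => //.
- exact: measurable_EFin_profile.
- by apply: measurable_funeM; exact: mpow.
move=> s; rewrite /= in_itv /= andbT => Js.
by rewrite -EFinM lee_fin profile_le // (lt_le_trans J0).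
Qed.

Definition mst_constant : R := \int[mu]_(s in `[0, +oo[) kappa_profile s.

Let integral_profile_split :
  (\int[mu]_(s in `[0%R, +oo[) (kappa_profile s)%:E =
   \int[mu]_(s in `[0%R, 1%R[) (kappa_profile s)%:E +
   \int[mu]_(s in `[1%R, +oo[) (kappa_profile s)%:E)%E.
Proof. by apply: ge0_integral_itvy_split. Qed.

Lemma mst_constantE :
  mst_constant%:E = (\int[mu]_(s in `[0%R, +oo[) (kappa_profile s)%:E)%E.
Proof.
rewrite /mst_constant /Rintegral fineK // ge0_fin_numE; last exact: integral_ge0.
have [C C0 tail] := integral_kappa_profile_tail ltr01.
rewrite integral_profile_split; apply: lte_add_pinfty; last first.
  by apply: le_lt_trans (tail 1 ltr01) _; rewrite ltry.
apply: (@le_lt_trans _ _ (\int[mu]_(s in `[0%R, 1%R[) 1)%E).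
  apply: ge0_le_integral => //; first exact: measurable_EFin_profile.
  by move=> s _; rewrite lee_fin kappa_profile_le1.
by rewrite integral_itv_cst ?ltry.
Qed.

Lemma mst_constant_gt0 : 0 < mst_constant.
Proof.
rewrite -lte_fin mst_constantE integral_profile_split.
apply: (@lt_le_trans _ _ (\int[mu]_(s in `[0%R, 1%R[) (expR (- 1))%:E)%E).
  by rewrite integral_itv_cst // subr0 mulr1 lte_fin expR_gt0.
apply: (@le_trans _ _ (\int[mu]_(s in `[0%R, 1%R[) (kappa_profile s)%:E)%E).
  apply: ge0_le_integral => //; first exact: measurable_EFin_profile.
  move=> s /=; rewrite in_itv /= lee_fin => /andP[s0 /ltW s1].
  apply: le_trans (kappa_density_ge_expR (powR_ge0 s q)); rewrite ler_expR lerN2.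
  have -> : 1 = 1 `^ q by rewrite powR1.
  by rewrite ge0_ler_powR ?nnegrE ?(ltW q_gt0).
by rewrite leeDl // integral_ge0.
Qed.
End kappa_profile.

(** * Kruskal's formula *)

Lemma sum_mul_indic_fiber (R : realType) (T : Type) (S : finType) (g : T -> S)
    (h : S -> R) (w : T) :
  h (g w) = \sum_s h s * \1_[set x | g x = s] w.
Proof.
rewrite (bigD1 (g w)) //= indicE mem_set // mulr1 big1 ?addr0 // => s ws.
by rewrite indicE memNset ?mulr0 // => /esym/eqP; rewrite (negPf ws).
Qed.

Section sublevel.
Variables (R : realType) (I : finType).
Implicit Types (x : I -> R) (s t : R) (A E : {set I}).
Local Notation mu := (@lebesgue_measure R).

Definition sublevel x t : {set I} := [set i | x i <= t]%SET.

Lemma sublevel_subset x s t : s <= t -> sublevel x s \subset sublevel x t.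
Proof. by move=> st; apply/fintype.subsetP => i; rewrite !inE => /le_trans; exact. Qed.

Section measurability.
Variables (d : measure_display) (T : measurableType d).
Variables (X : I -> T -> R) (level : T -> R).
Hypothesis measurable_X : forall i, measurable_fun setT (X i).
Hypothesis measurable_level : measurable_fun setT level.

Lemma measurable_sublevel_eq E :
  measurable [set w | sublevel (X ^~ w) (level w) = E].
Proof.
have -> : [set w | sublevel (X ^~ w) (level w) = E] =
    \bigcap_(i in [set: I]) ((fun w => X i w <= level w) @^-1` [set i \in E]).
  apply/seteqP; split=> w /=; first by move=> <- i _; rewrite /= inE.
  by move=> wE; apply/setP => i; rewrite inE; exact: wE.
apply: fin_bigcap_measurable => // i _; rewrite -[X in measurable X]setTI.
by apply: measurable_fun_ler.
Qed.

Lemma measurable_fun_sublevel (h : T -> {set I} -> R) :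
  (forall E, measurable_fun setT (h ^~ E)) ->
  measurable_fun setT (fun w => h w (sublevel (X ^~ w) (level w))).
Proof.
move=> mh; pose G w := sublevel (X ^~ w) (level w).
have -> : (fun w => h w (G w)) = (fun w => \sum_E h w E * \1_[set w | G w = E] w).
  by apply/funext => w; exact: (sum_mul_indic_fiber G (h w)).
apply: measurable_sum => E; apply: measurable_funM => //.
by apply: measurable_indic; exact: measurable_sublevel_eq.
Qed.
End measurability.

Lemma measurable_fun_sublevelr x (h : {set I} -> R) :
  measurable_fun setT (fun t => h (sublevel x t)).
Proof.
exact: (@measurable_fun_sublevel _ _ (fun i => cst (x i)) id _ _ (fun=> h)).
Qed.

Lemma sum_gt_sublevel x t A :
  \sum_(i in A) (t < x i)%R%:R = #|A :\: sublevel x t|%:R :> R.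
Proof.
rewrite -sum1_card natr_sum big_mkcond [RHS]big_mkcond; apply: eq_bigr => i _.
by rewrite !inE ltNge; case: (i \in A); case: (x i <= t).
Qed.

Lemma lt_indicE (a : R) : (fun t : R => (t < a)%R%:R) = \1_`]-oo, a[ :> (R -> R).
Proof.
by apply/funext => t; rewrite indicE; congr (nat_of_bool _)%:R; rewrite mem_setE in_itv.
Qed.

Lemma integral_lt_indic (a : R) : 0 <= a ->
  (\int[mu]_(t in `[0%R, +oo[) (t < a)%R%:R%:E = a%:E)%E.
Proof.
move=> a0; under eq_integral do rewrite -[_%:R]/((fun t => (t < a)%R%:R) _) lt_indicE.
rewrite integral_indic // (_ : _ `&` _ = `[0, a[%classic); last first.
  by apply/seteqP; split=> t /=; rewrite !in_itv /= andbT andbC => /andP[].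
rewrite /= lebesgue_measure_itv /= lte_fin; case: ltP => [_|a_le0].
  by rewrite oppr0 adde0.
by congr _%:E; apply/le_anti; rewrite a0 a_le0.
Qed.

Lemma integral_card_setD_sublevel x A : (forall i, 0 <= x i) ->
  (\int[mu]_(t in `[0%R, +oo[) #|A :\: sublevel x t|%:R%:E = (\sum_(i in A) x i)%:E)%E.
Proof.
move=> x0; under eq_integral do rewrite -sum_gt_sublevel -sumEFin -big_enum.
rewrite ge0_integral_sum //.
- by rewrite big_enum -sumEFin; apply: eq_bigr => i _; exact: integral_lt_indic.
- by move=> i; apply/measurable_EFinP; rewrite lt_indicE.
Qed.
End sublevel.

Section kruskal.
Variables (R : realType) (n : nat) (x : edge n -> R).
Hypotheses (n_gt0 : (0 < n)%N) (x_ge0 : forall e, 0 <= x e).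
Local Notation mu := (@lebesgue_measure R).

(* Sorting the edges by the size of their sublevel set makes the sublevel sets
   a chain indexed by [nat], each one being reached at the index equal to its size. *)
Lemma kruskal_tree : exists2 T, spanning_tree T &
  forall t, #|T :\: sublevel x t| = (kappa (sublevel x t)).-1.
Proof.
pose G (i : nat) : {set edge n} := [set e | (#|sublevel x (x e)| <= i)%N]%SET.
have sublevelE t : sublevel x t = G #|sublevel x t|.
  apply/setP => e; rewrite !inE; apply/idP/idP => [xet|].
    by apply: subset_leq_card; exact: sublevel_subset.
  apply: contraTT; rewrite -ltNge -ltnNge => txe; apply: proper_card.
  rewrite properE sublevel_subset ?(ltW txe) //=.
  by apply/fintype.subsetPn; exists e; rewrite !inE // -ltNge.
have [||T treeT TG] := @chain_spanning_tree n G #|{: edge n}| n_gt0.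
- by move=> i j ij; apply/fintype.subsetP => e; rewrite !inE => /leq_trans; exact.
- by apply/setP => e; rewrite !inE max_card.
by exists T => // t; rewrite sublevelE TG ?max_card.
Qed.

Lemma mst_weight_integral :
  (\int[mu]_(t in `[0%R, +oo[) (kappa (sublevel x t)).-1%:R%:E = (mst_weight x)%:E)%E.
Proof.
have [T treeT TG] := kruskal_tree.
under eq_integral do rewrite -TG.
rewrite integral_card_setD_sublevel //; congr _%:E.
have [[T' treeT' ->] min_weight] := mst_weight_min x n_gt0.
apply/le_anti; rewrite min_weight // andbT -lee_fin -!integral_card_setD_sublevel //.
apply: ge0_le_integral => //.
- apply/measurable_EFinP; apply: measurable_funTS.
  exact: (measurable_fun_sublevelr x (fun E => #|T :\: E|%:R)).
- apply/measurable_EFinP; apply: measurable_funTS.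
  exact: (measurable_fun_sublevelr x (fun E => #|T' :\: E|%:R)).
move=> t _; rewrite lee_fin ler_nat TG -ltnS prednK ?kappa_gt0 //.
by case: treeT' => _ connT' _; exact: connected_kappa_le_cardsD.
Qed.

Let measurable_sublevel (D : set R) (h : {set edge n} -> R) :
  measurable_fun D (fun t => (h (sublevel x t))%:E).
Proof.
apply/measurable_EFinP; apply: measurable_funTS; exact: measurable_fun_sublevelr.
Qed.

Lemma mst_weight_integral_connected (J : R) :
  0 <= J -> (kappa (sublevel x J) <= 1)%N ->
  (\int[mu]_(t in `[0%R, J[) ((kappa (sublevel x t))%:R / n%:R)%:E =
   (mst_weight x / n%:R + J / n%:R)%:E)%E.
Proof.
move=> J0 conJ; have n0 : 0 < n%:R :> R by rewrite ltr0n.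
have -> : mst_weight x / n%:R + J / n%:R = n%:R^-1 * (mst_weight x + 1 * (J - 0)) by ring.
rewrite EFinM EFinD -mst_weight_integral -integral_itv_cst //.
have mpred (D : set R) := @measurable_sublevel D (fun E => (kappa E).-1%:R).
rewrite (ge0_integral_itvy_split J0 (mpred _)) //.
rewrite [X in (_ + X + _)%E]integral0_eq => [|t]; last first.
  rewrite /= in_itv /= andbT => Jt; suff /eqP -> : ((kappa (sublevel x t)).-1 == 0)%N by [].
  rewrite -subn1 subn_eq0; apply: leq_trans conJ.
  by apply: kappa_subset; exact: sublevel_subset.
rewrite adde0 -ge0_integralD //; last exact: mpred.
rewrite -ge0_integralZl_EFin ?invr_ge0 //; last 2 first.
- by move=> t _; rewrite adde_ge0.
- exact: (@measurable_sublevel _ (fun E => (kappa E).-1%:R + 1)).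
apply: eq_integral => t _; rewrite -EFinD -EFinM; congr _%:E.
by rewrite natr1 prednK ?kappa_gt0 // mulrC.
Qed.

Lemma mst_weight_dist_le (f : R -> R) (c J tau : R) :
  measurable_fun setT f -> (forall t, 0 <= f t) -> 0 <= J ->
  c%:E = (\int[mu]_(t in `[0%R, +oo[) (f t)%:E)%E ->
  (\int[mu]_(t in `[J, +oo[) (f t)%:E <= tau%:E)%E ->
  (kappa (sublevel x J) <= 1)%N ->
  (`|mst_weight x / n%:R - c|%:E <=
   \int[mu]_(t in `[0%R, J[) `|(kappa (sublevel x t))%:R / n%:R - f t|%:E +
   (J / n%:R + tau)%:E)%E.
Proof.
move=> mf f0 J0 cE tailJ conJ; have n0 : 0 < n%:R :> R by rewrite ltr0n.
pose K t : R := (kappa (sublevel x t))%:R / n%:R; pose D : set R := `[0, J[%classic.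
have K0 t : 0 <= K t by rewrite divr_ge0.
have mK : measurable_fun D K.
  by apply/measurable_EFinP; exact: (@measurable_sublevel _ (fun E => (kappa E)%:R / n%:R)).
have mfD : measurable_fun D f by apply: measurable_funTS.
have mD : measurable D by exact: measurable_itv.
have := ge0_integral_dist mu mD mK mfD (fun t _ => K0 t) (fun t _ => f0 t).
have := ge0_integral_dist mu mD mfD mK (fun t _ => f0 t) (fun t _ => K0 t).
have -> : (\int[mu]_(t in D) `|f t - K t|%:E = \int[mu]_(t in D) `|K t - f t|%:E)%E.
  by apply: eq_integral => t _; rewrite distrC.
rewrite mst_weight_integral_connected // -/D.
have mf' : measurable_fun (`[0, +oo[ : set R) (EFin \o f).
  by apply/measurable_EFinP; apply: measurable_funTS.
have f0' (t : R) : 0 <= t -> (0 <= (EFin \o f) t)%E by rewrite lee_fin.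
move: cE tailJ; rewrite (ge0_integral_itvy_split J0 mf' f0') -/D /=.
have : (0 <= \int[mu]_(t in D) `|K t - f t|%:E)%E by exact: integral_ge0.
have : (0 <= \int[mu]_(t in D) (f t)%:E)%E by apply: integral_ge0 => t _; rewrite lee_fin.
have : (0 <= \int[mu]_(t in `[J, +oo[) (f t)%:E)%E.
  by apply: integral_ge0 => t _; rewrite lee_fin.
rewrite -/(K _); set Y := (\int[mu]_(t in D) `|K t - f t|%:E)%E.
set a := (\int[mu]_(t in D) (f t)%:E)%E; set b := (\int[mu]_(t in `[J, +oo[) _)%E.
case: Y => [y| |] //; last by rewrite addye ?leey.
case: a => [a| |] //; case: b => [b| |] //=.
rewrite -!EFinD !lee_fin => b0 a0 y0 [->] btau fK Kf.
have Jn0 : 0 <= J / n%:R by rewrite divr_ge0.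
by rewrite ler_norml; apply/andP; split; lra.
Qed.
End kruskal.

Lemma mst_weightZ (R : realType) n (x : edge n -> R) (a : R) : (0 < n)%N -> 0 <= a ->
  mst_weight (fun e => a * x e) = a * mst_weight x.
Proof.
move=> n0 a0; have [[T treeT TE] min_x] := mst_weight_min x n0.
have [[T' treeT' T'E] min_ax] := mst_weight_min (fun e => a * x e) n0.
apply/le_anti/andP; split.
  by rewrite TE mulr_sumr; exact: min_ax.
by rewrite T'E -mulr_sumr ler_wpM2l //; exact: min_x.
Qed.

(** * Threshold graphs of the random weights *)

Lemma ge0_markov (R : realType) d (T : measurableType d) (m : {measure set T -> \bar R})
    (g : T -> \bar R) (a b : R) :
  measurable_fun setT g -> (forall x, 0 <= g x)%E -> 0 < a ->
  (\int[m]_x g x <= b%:E)%E -> (m [set x | a%:E <= g x]%E <= (b / a)%:E)%E.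
Proof.
move=> mg g0 a0 gb; rewrite -(@lee_pmul2l _ a%:E) // -EFinM mulrCA divff ?gt_eqF // mulr1.
apply: le_trans gb.
have := @le_integral_comp_abse _ _ _ m setT measurableT g a id (@measurable_id _ _ _)
  (fun r r0 => r0) (fun x y _ _ xy => xy) mg a0.
rewrite setTI; under eq_integral do rewrite gee0_abs //.
by under eq_set do rewrite gee0_abs //.
Qed.

Lemma measurable_bernoulli_mean (R : realType) (I : finType) d (T : measurableType d)
    (p : T -> R) (h : T -> {set I} -> R) :
  measurable_fun setT p -> (forall E, measurable_fun setT (h ^~ E)) ->
  measurable_fun setT (fun w => bernoulli_mean (p w) (h w)).
Proof.
move=> mp mh; apply: measurable_sum => E; apply: measurable_funM => //.
apply: measurable_prod => i _; case: (i \in E) => //.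
exact: measurable_funB.
Qed.

Section root_law.
Variables (R : realType) (q : R) (d : measure_display) (Omega : measurableType d).
Variables (P : probability Omega R) (X : {RV P >-> R}).
Hypotheses (q_gt0 : 0 < q) (law : uniform_root_law q X).

Lemma uniform_root_law_cdf (t : R) : 0 <= t <= 1 -> P [set w | X w <= t] = (t `^ q)%:E.
Proof.
move=> /andP[t0 t1]; have tq0 : 0 <= t `^ q by exact: powR_ge0.
have rootK u : 0 <= u -> (u `^ q^-1) `^ q = u.
  by move=> u0; rewrite -powRrM mulVf ?gt_eqF // powRr1.
have powK : (t `^ q) `^ q^-1 = t by rewrite -powRrM divff ?gt_eqF // powRr1.
have tq1 : t `^ q <= 1.
  by rewrite -(rootK 1 ler01) powR1 ge0_ler_powR ?nnegrE ?(ltW q_gt0).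
have preimE : (fun u : R => u `^ q^-1) @^-1` `]-oo, t] `&` `[0, 1] = `[0, t `^ q]%classic.
  apply/seteqP; split=> u /=; rewrite !in_itv /=.
    move=> [ut /andP[u0 _]]; rewrite u0 -[leLHS]rootK //.
    by rewrite ge0_ler_powR ?nnegrE ?(ltW q_gt0) ?powR_ge0.
  move=> /andP[u0 ut]; rewrite u0 (le_trans ut) //; split=> //.
  by rewrite -powK ge0_ler_powR ?nnegrE ?invr_ge0 ?(ltW q_gt0).
have -> : [set w | X w <= t] = X @^-1` `]-oo, t].
  by apply/seteqP; split=> w /=; rewrite in_itv.
have := law (measurable_itv `]-oo, t]); rewrite /distribution /pushforward => ->.
rewrite /uniform_prob integral_uniform_pdf preimE (eq_integral (cst 1%E)) => [|u].
  rewrite integral_cst //= lebesgue_measure_itv /= lte_fin mul1e.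
  case: ltP => [_|tq_le0]; first by rewrite oppr0 adde0.
  by congr _%:E; apply/le_anti; rewrite tq_le0 tq0.
rewrite inE /= in_itv /= => /andP[u0 ut].
by rewrite /uniform_pdf u0 (le_trans ut tq1) /= subr0 invr1.
Qed.

Lemma uniform_root_law_ge0 : {ae P, forall w, 0 <= X w}.
Proof.
exists (X @^-1` `]-oo, 0[); split=> [||w /= /negP]; last by rewrite in_itv /= -ltNge.
  exact: measurable_funPTI.
have := law (measurable_itv `]-oo, 0[); rewrite /distribution /pushforward => ->.
rewrite (_ : _ @^-1` _ = set0) ?measure0 //.
by apply/seteqP; split=> u //=; rewrite in_itv /= ltNge powR_ge0.
Qed.
End root_law.

Section random_sublevel.
Variables (R : realType) (q : R) (d : measure_display) (Omega : measurableType d).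
Variables (P : probability Omega R) (I : finType) (X : I -> {RV P >-> R}).
Hypotheses (q_gt0 : 0 < q) (indepX : independent_RVs X).
Hypothesis lawX : forall i, uniform_root_law q (X i).
Implicit Types (t : R) (E : {set I}).
Local Notation mu := (@lebesgue_measure R).

Definition random_sublevel t (w : Omega) : {set I} := sublevel (fun i => X i w) t.

Lemma prob_random_sublevel_eq t E : 0 <= t <= 1 ->
  P [set w | random_sublevel t w = E] = (bernoulli_weight (t `^ q) E)%:E.
Proof.
move=> t01; pose below : set R := [set x | x <= t].
have mbelow : measurable below.
  by rewrite /below -set_itvNyc; exact: measurable_itv.
pose B i := if i \in E then below else ~` below.
have mB i : measurable (B i) by rewrite /B; case: ifP => _ //; exact: measurableC.
have -> : [set w | random_sublevel t w = E] =
    \bigcap_(i in [set` [set: I]%SET]) (X i @^-1` B i).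
  apply/seteqP; split=> w /=.
    by move=> wE i _; rewrite /B -wE inE /below /=; case: ifPn => //= /negP.
  move=> BX; apply/setP => i; have := BX i; rewrite /= !inE => /(_ isT).
  by rewrite /B /below; case: (i \in E) => //= /negP/negPf.
rewrite indepX // /bernoulli_weight -prodEFin.
apply: eq_big => [i|i _]; first by rewrite inE.
have cdf := uniform_root_law_cdf q_gt0 (lawX i) t01.
rewrite /B; case: ifP => _; first exact: cdf.
by rewrite preimage_setC probability_setC ?cdf //; exact: (measurable_funPTI (X i) mbelow).
Qed.

Lemma integral_random_sublevel (h : {set I} -> R) t : 0 <= t <= 1 ->
  (forall E, 0 <= h E) ->
  (\int[P]_w (h (random_sublevel t w))%:E = (bernoulli_mean (t `^ q) h)%:E)%E.
Proof.
move=> t01 h0; pose fiber E := [set w | random_sublevel t w = E].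
have mfiber E : measurable (fiber E).
  exact: (@measurable_sublevel_eq _ _ _ _ (fun i => X i) (cst t)).
under eq_integral do rewrite (sum_mul_indic_fiber (random_sublevel t)) -sumEFin.
rewrite ge0_integral_sum //; last 2 first.
- move=> E; apply/measurable_EFinP; apply: measurable_funM => //.
  by apply: measurable_indic; exact: mfiber.
- by move=> E w _; rewrite lee_fin mulr_ge0 // indicE.
rewrite /bernoulli_mean -sumEFin; apply: eq_bigr => E _.
under eq_integral do rewrite EFinM.
rewrite ge0_integralZl_EFin //; last first.
  by apply/measurable_EFinP; apply: measurable_indic; exact: mfiber.
rewrite integral_indic //; last exact: mfiber.
by rewrite /= setIT prob_random_sublevel_eq // muleC.
Qed.

Lemma measurable_random_sublevel_pred (Q : pred {set I}) t :
  measurable [set w | Q (random_sublevel t w)].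
Proof.
have -> : [set w | Q (random_sublevel t w)] =
    \bigcup_(E in [set` Q]) [set w | random_sublevel t w = E].
  by apply/seteqP; split=> w /= => [Qw|[E QE ->] //]; exists (random_sublevel t w).
apply: fin_bigcup_measurable => // E _.
exact: (@measurable_sublevel_eq _ _ _ _ (fun i => X i) (cst t)).
Qed.

Lemma prob_random_sublevel (Q : pred {set I}) t : 0 <= t <= 1 ->
  P [set w | Q (random_sublevel t w)] =
  (bernoulli_mean (t `^ q) (fun E => (Q E)%:R))%:E.
Proof.
move=> t01; rewrite -(integral_random_sublevel t01 (fun E => ler0n R (Q E))).
have mQ := measurable_random_sublevel_pred Q t.
rewrite -[in LHS](setIT [set w | _]) -integral_indic //.
by apply: eq_integral => w _; rewrite indicE mem_setE.
Qed.

Section integrated_level.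
Variables (D : set R) (level : R -> R) (h : R -> {set I} -> R).
Hypotheses (mD : measurable D) (mlevel : measurable_fun setT level).
Hypothesis level01 : forall s, D s -> 0 <= level s <= 1.
Hypothesis h_ge0 : forall s E, 0 <= h s E.
Hypothesis mh : forall E, measurable_fun setT (h ^~ E).

Let joint (ws : Omega * R) : \bar R :=
  (h ws.2 (random_sublevel (level ws.2) ws.1) * \1_D ws.2)%:E.

Let measurable_joint : measurable_fun setT joint.
Proof.
apply/measurable_EFinP; apply: measurable_funM.
  apply: (@measurable_fun_sublevel _ _ _ _ (fun i ws => X i ws.1) (level \o snd) _ _
    (fun ws E => h ws.2 E)) => [i||E].
  - exact: measurableT_comp.
  - exact: measurableT_comp.
  - exact: measurableT_comp (mh E) measurable_snd.
by apply: measurableT_comp => //; exact: measurable_indic.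
Qed.

Let joint_ge0 ws : (0 <= joint ws)%E.
Proof. by rewrite lee_fin mulr_ge0 // indicE. Qed.

Let integral_joint w :
  (\int[mu]_s joint (w, s) = \int[mu]_(s in D) (h s (random_sublevel (level s) w))%:E)%E.
Proof. by rewrite [RHS]integral_mkcond epatch_indic. Qed.

Lemma measurable_integral_random_sublevel :
  measurable_fun setT (fun w => \int[mu]_(s in D) (h s (random_sublevel (level s) w))%:E)%E.
Proof.
under eq_fun do rewrite -integral_joint.
exact: measurable_fun_fubini_tonelli_F.
Qed.

Lemma integral_integral_random_sublevel :
  (\int[P]_w \int[mu]_(s in D) (h s (random_sublevel (level s) w))%:E =
   \int[mu]_(s in D) (bernoulli_mean (level s `^ q) (h s))%:E)%E.
Proof.
under eq_integral do rewrite -integral_joint.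
rewrite fubini_tonelli // [RHS]integral_mkcond; apply: eq_integral => s _.
rewrite /joint /= patchE; case: ifPn => Ds; rewrite indicE.
  rewrite Ds -integral_random_sublevel //; last exact/level01/set_mem.
  by under eq_integral do rewrite mulr1.
by rewrite (negPf Ds); under eq_integral do rewrite mulr0; rewrite integral0.
Qed.
End integrated_level.
End random_sublevel.

(** * Deviation bound for a fixed number of vertices *)

Lemma sublevelZ (R : realType) (I : finType) (x : I -> R) (a s : R) : 0 < a ->
  sublevel (fun i => a * x i) s = sublevel x (s / a).
Proof. by move=> a0; apply/setP => i; rewrite !inE ler_pdivlMr // mulrC. Qed.

Lemma measurable_mst_weight (R : realType) d (T : measurableType d) n
    (X : edge n -> T -> R) : (0 < n)%N -> (forall e, measurable_fun setT (X e)) ->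
  measurable_fun setT (fun w => mst_weight (X ^~ w)).
Proof.
move=> n0 mX; apply: (measurability (@RGenCInfty.G R)) => [|/= _ [_] [r] -> <-].
  exact: RGenCInfty.measurableE.
rewrite setTI; pose trees := [set` [pred A : {set edge n} | `[< spanning_tree A >]]].
rewrite (_ : _ @^-1` _ = \bigcap_(A in trees) [set w | r <= \sum_(e in A) X e w]);
    last first.
  apply/seteqP; split=> w /=; rewrite in_itv /= andbT.
    move=> rM A /asboolP treeA; apply: le_trans rM _.
    by have [_ +] := mst_weight_min (X ^~ w) n0; apply.
  have [[A treeA ->] _] := mst_weight_min (X ^~ w) n0.
  by apply; apply/asboolP.
apply: fin_bigcap_measurable => // A _; rewrite -[X in measurable X]setTI.
apply: measurable_fun_le => //; under eq_fun do rewrite -big_enum.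
exact: measurable_sum.
Qed.

Lemma measurable_superlevel (R : realType) d (T : measurableType d) (f : T -> R) (r : R) :
  measurable_fun setT f -> measurable [set w | r < f w].
Proof.
move=> mf; have := mf measurableT `]r, +oo[%classic (measurable_itv _).
by rewrite setTI; congr measurable; apply/seteqP; split=> w /=; rewrite in_itv /= andbT.
Qed.

Section deviation.
Variables (R : realType) (q : R) (d : measure_display) (Omega : measurableType d).
Variables (P : probability Omega R) (n : nat) (X : edge n -> {RV P >-> R}).
Hypotheses (q_gt0 : 0 < q) (n_gt0 : (0 < n)%N) (indepX : independent_RVs X).
Hypothesis lawX : forall e, uniform_root_law q (X e).
Local Notation mu := (@lebesgue_measure R).

Definition rescaled_mst_weight (w : Omega) : R :=
  n%:R `^ (q^-1 - 1) * mst_weight (fun e => X e w).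

Lemma measurable_rescaled_mst_weight : measurable_fun setT rescaled_mst_weight.
Proof.
by apply: measurable_funM => //; exact: (measurable_mst_weight (X := fun e => X e)).
Qed.

Let scale : R := n%:R `^ q^-1.

Let n_gt0R : 0 < n%:R :> R. Proof. by rewrite ltr0n. Qed.

Let scale_gt0 : 0 < scale. Proof. exact: powR_gt0. Qed.

Let scale_powR : scale `^ q = n%:R.
Proof. by rewrite -powRrM mulVf ?gt_eqF // powRr1 // ltW. Qed.

Let powR_level s : 0 <= s -> (s / scale) `^ q = s `^ q / n%:R.
Proof.
move=> s0; rewrite powRM ?invr_ge0 ?(ltW scale_gt0) //; congr (_ * _).
rewrite -scale_powR -powR_inv1 ?(ltW scale_gt0) // -powRrM mulN1r powRN.
by rewrite scale_powR.
Qed.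

Lemma rescaled_mst_weightE w :
  rescaled_mst_weight w = mst_weight (fun e => scale * X e w) / n%:R.
Proof.
rewrite mst_weightZ ?(ltW scale_gt0) // /rescaled_mst_weight powRB; last first.
  by rewrite (gt_eqF n_gt0R) implybT.
by rewrite powRr1 ?(ltW n_gt0R) // mulrAC.
Qed.

Section truncation.
Variable J : R.
Hypotheses (J_ge0 : 0 <= J) (JqN : J `^ q <= n%:R).

Let powR_le_J s : 0 <= s -> s <= J -> s `^ q <= J `^ q.
Proof. by move=> s0 sJ; rewrite ge0_ler_powR ?nnegrE ?(ltW q_gt0). Qed.

Let level_itv01 s : 0 <= s -> s <= J -> 0 <= s / scale <= 1.
Proof.
move=> s0 sJ; rewrite divr_ge0 ?(ltW scale_gt0) //= ler_pdivrMr // mul1r.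
rewrite leNgt; apply/negP => scale_s; move: (le_trans (powR_le_J s0 sJ) JqN).
by rewrite leNgt -scale_powR gt0_ltr_powR ?nnegrE ?(ltW scale_gt0).
Qed.

Lemma prob_disconnected_le :
  (P [set w | 1 < kappa (random_sublevel X (J / scale) w)]%N <=
   ((1 + expR (- (J `^ q / 2))) ^+ n - 1)%:E)%E.
Proof.
have level01 := level_itv01 J_ge0 (lexx J).
rewrite (prob_random_sublevel q_gt0 indepX lawX (fun E => (1 < kappa E)%N)) //.
rewrite lee_fin powR_level //.
have p01 : 0 <= J `^ q / n%:R <= 1 by rewrite divr_ge0 ?powR_ge0 //= ler_pdivrMr // mul1r.
apply: bernoulli_mean_disconnected_le => // m nm.
apply: le_trans (exprn_onem_le_expR m _) _; first by case/andP: p01.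
rewrite ler_expR lerN2 mulrCA ler_wpM2l ?powR_ge0 // ler_pdivlMr // mulrC.
by rewrite ler_pdivrMr // -natrM ler_nat muln2.
Qed.

Definition kappa_discrepancy (w : Omega) : \bar R :=
  (\int[mu]_(s in `[0%R, J[)
     `|(kappa (random_sublevel X (s / scale) w))%:R / n%:R - kappa_profile q s|%:E)%E.

Let discrepancy (s : R) (E : {set edge n}) : R :=
  `|(kappa E)%:R / n%:R - kappa_profile q s|.

Let discrepancy_ge0 s E : 0 <= discrepancy s E. Proof. exact: normr_ge0. Qed.

Let measurable_discrepancy E : measurable_fun setT (discrepancy ^~ E).
Proof.
apply: measurableT_comp => //; apply: measurable_funB => //.
exact: measurable_kappa_profile.
Qed.

Let measurable_level : measurable_fun setT (fun s : R => s / scale).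
Proof. by apply: measurable_funM. Qed.

Lemma measurable_kappa_discrepancy : measurable_fun setT kappa_discrepancy.
Proof.
exact: (measurable_integral_random_sublevel X (measurable_itv _) measurable_level
  discrepancy_ge0 measurable_discrepancy).
Qed.

Lemma integral_kappa_discrepancy_le :
  (\int[P]_w kappa_discrepancy w <=
   (3 * (1 + J `^ q) / Num.sqrt n%:R * J)%:E)%E.
Proof.
have level01 s : `[0, J[%classic s -> 0 <= s / scale <= 1.
  by rewrite /= in_itv /= => /andP[s0 /ltW]; exact: level_itv01.
rewrite (integral_integral_random_sublevel q_gt0 indepX lawX (measurable_itv _)
  measurable_level level01 discrepancy_ge0 measurable_discrepancy).
rewrite -[X in (_ <= (_ * X)%:E)%E]subr0 -integral_itv_cst //.
apply: ge0_le_integral => //.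
- move=> s /=; rewrite in_itv /= => /andP[s0 /ltW sJ]; rewrite lee_fin.
  apply: bernoulli_mean_ge0 => //; rewrite powR_level // divr_ge0 ?powR_ge0 //=.
  by rewrite ler_pdivrMr // mul1r (le_trans (powR_le_J s0 sJ)).
- apply/measurable_EFinP; apply: measurable_funTS.
  by apply: measurable_bernoulli_mean => //; exact: measurableT_comp (measurable_powR _) _.
move=> s /=; rewrite in_itv /= => /andP[s0 /ltW sJ]; rewrite lee_fin powR_level //.
have sqJ := powR_le_J s0 sJ.
apply: le_trans (bernoulli_mean_kappa_dist n_gt0 _) _.
  by rewrite powR_ge0 (le_trans sqJ).
by rewrite ler_pM2r ?invr_gt0 ?sqrtr_gt0 // ler_pM2l // lerD2l.
Qed.

Section tail.
Variable tau : R.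
Hypothesis tail_le :
  (\int[mu]_(s in `[J, +oo[) (kappa_profile q s)%:E <= tau%:E)%E.

Lemma rescaled_mst_weight_dist_le w : (forall e, 0 <= X e w) ->
  (kappa (random_sublevel X (J / scale) w) <= 1)%N ->
  (`|rescaled_mst_weight w - mst_constant q|%:E <=
   kappa_discrepancy w + (J / n%:R + tau)%:E)%E.
Proof.
move=> X_ge0; rewrite /kappa_discrepancy /random_sublevel -sublevelZ // => conJ.
under eq_integral do rewrite -sublevelZ //.
rewrite rescaled_mst_weightE; apply: mst_weight_dist_le => //.
- by move=> e; rewrite mulr_ge0 ?(ltW scale_gt0).
- exact: measurable_kappa_profile.
- exact: kappa_profile_ge0.
- exact: mst_constantE.
Qed.

Lemma mst_deviation_le y r : 0 < y -> y + (J / n%:R + tau) <= r ->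
  (P [set w | (r < `|rescaled_mst_weight w - mst_constant q|)%R] <=
   (3 * (1 + J `^ q) / Num.sqrt n%:R * J / y +
    ((1 + expR (- (J `^ q / 2))) ^+ n - 1))%:E)%E.
Proof.
move=> y0 yr; set A := [set w | _].
pose disconnected := [set w | (1 < kappa (random_sublevel X (J / scale) w))%N].
pose discrepant := [set w | (y%:E <= kappa_discrepancy w)%E].
have [N [mN PN X_ge0]] : {ae P, forall w, forall e, 0 <= X e w}.
  by apply: filter_forall => e; exact: uniform_root_law_ge0 (lawX e).
have AB : A `<=` (discrepant `|` disconnected) `|` N.
  move=> w Aw; apply: contrapT => /not_orP[/not_orP[/negP + /negP +] notN].
  rewrite -ltNge -leqNgt => Yy conJ.
  have Xw : forall e, 0 <= X e w by apply: contrapT => negX; exact/notN/X_ge0.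
  have := rescaled_mst_weight_dist_le Xw conJ; apply/negP; rewrite -ltNge.
  apply: lt_le_trans (_ : (y%:E + (J / n%:R + tau)%:E <= _)%E).
    by rewrite lteD2rE.
  by rewrite -EFinD lee_fin (le_trans yr) // ltW.
have mA : measurable A.
  apply: measurable_superlevel; apply: measurableT_comp => //.
  by apply: measurable_funB => //; exact: measurable_rescaled_mst_weight.
have mdisc : measurable discrepant.
  rewrite -[X in measurable X]setTI.
  by apply: emeasurable_fun_c_infty => //; exact: measurable_kappa_discrepancy.
have mdisconn : measurable disconnected.
  exact: (measurable_random_sublevel_pred X (fun E => 1 < kappa E)%N).
apply: (@le_trans _ _ (P ((discrepant `|` disconnected) `|` N))).
  by apply: le_measure; rewrite ?inE //; do !apply: measurableU.
rewrite measureU0 //; last exact: measurableU.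
apply: le_trans (measureU2 _ _ _) _ => //; rewrite EFinD; apply: leeD.
  apply: ge0_markov => //; [exact: measurable_kappa_discrepancy| |].
    by move=> w; exact: integral_ge0.
  exact: integral_kappa_discrepancy_le.
exact: prob_disconnected_le.
Qed.
End tail.
End truncation.
End deviation.

(** * Asymptotics *)

Lemma onem_le_prob_sublevel (R : realType) d (T : measurableType d) (P : probability T R)
    (f : T -> R) (r e : R) : measurable_fun setT f ->
  ((1 - e)%:E <= P [set w | f w <= r]%R)%E = (P [set w | r < f w]%R <= e%:E)%E.
Proof.
move=> mf; have mB := measurable_superlevel r mf.
have -> : [set w | f w <= r] = ~` [set w | r < f w].
  by apply/seteqP; split=> w /=; rewrite leNgt => /negP.
rewrite probability_setC // -(fineK (fin_num_measure P _ mB)) -EFinB !lee_fin.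
by rewrite lerD2l lerN2.
Qed.

Lemma bigO_prob_littleo (R : realType) (d : nat -> measure_display)
    (Omega : forall n, measurableType (d n)) (P : forall n, probability (Omega n) R)
    (Y : forall n, Omega n -> R) (r : nat -> R) :
  (\forall n \near \oo, measurable_fun setT (Y n)) -> (forall n w, 0 <= Y n w) ->
  bigO_prob P Y (fun n _ => r n) -> r @ \oo --> 0 ->
  littleo_prob P Y (fun _ _ => 1).
Proof.
move=> mY Y0 YO r0 eps eps0; pose A n := [set w | eps < `|Y n w / 1|].
have AE n : A n = [set w | eps < Y n w].
  by rewrite /A; under eq_set do rewrite divr1 ger0_norm //.
have mA : \forall n \near \oo, measurable (A n).
  by near=> n; rewrite AE; apply: measurable_superlevel; near: n.
apply/fine_cvgP; split; first by near=> n; apply: fin_num_measure; near: n.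
apply/cvgr0Pnorm_le => e e0; have [C C0 YC] := YO e e0.
have rC : \forall n \near \oo, C * r n <= eps.
  near=> n; rewrite mulrC -ler_pdivlMr //; apply: le_trans (ler_norm _) _.
  by near: n; apply: (cvgr0_norm_le _ r0); rewrite divr_gt0.
near=> n; have mAn : measurable (A n) by near: n.
rewrite /= ger0_norm ?fine_ge0 // -lee_fin fineK ?fin_num_measure //.
apply: (@le_trans _ _ (P n [set w | C * r n < Y n w])).
  apply: le_measure; rewrite ?inE //.
    by apply: measurable_superlevel; near: n.
  by rewrite -/(A n) AE => w /=; apply: le_lt_trans; near: n.
rewrite -onem_le_prob_sublevel; first by near: n; exact: YC.
by near: n.
Unshelve. all: by end_near. Qed.

Lemma cvg_exprn_onep (R : realType) (z : nat -> R) : (forall n, 0 <= z n) ->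
  n%:R * z n @[n --> \oo] --> 0 -> (1 + z n) ^+ n - 1 @[n --> \oo] --> 0.
Proof.
move=> z0 nz0; apply: (@squeeze_cvgr _ _ _ _ (cst 0) (fun n => expR (n%:R * z n) - 1)).
- near=> n; rewrite subr_ge0 exprn_ege1 ?lerDl //=.
  rewrite lerD2r expRM_natl lerXn2r ?nnegrE ?expR_ge0 ?addr_ge0 //.
  exact: expR_ge1Dx.
- exact: cvg_cst.
- rewrite -[X in _ --> X](subrr (1 : R)) -[X in _ --> X - _]expR0.
  by apply: cvgB; [apply: continuous_cvg => //; exact: continuous_expR|exact: cvg_cst].
Unshelve. all: by end_near. Qed.

Section truncation_level.
Variables (R : realType) (q : R).
Hypothesis q_gt0 : 0 < q.

Let q1_gt0 : 0 < q + 1. Proof. by rewrite addr_gt0. Qed.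

Definition rate : R := q / (2 * (q + 1)).

(* The truncation level [J = n ^ trunc_exponent] makes the error [J ^ (1 + q) / sqrt n]
   equal to [n ^ (- rate)]. *)
Definition trunc_exponent : R := (2 * (q + 1) ^+ 2)^-1.

Lemma rate_gt0 : 0 < rate.
Proof. by rewrite divr_gt0 // mulr_gt0. Qed.

Lemma trunc_exponent_gt0 : 0 < trunc_exponent.
Proof. by rewrite invr_gt0 mulr_gt0 // exprn_gt0. Qed.

Lemma trunc_exponent_rate : trunc_exponent * (1 + q) - 2^-1 = - rate.
Proof. by rewrite /trunc_exponent /rate; field; rewrite gt_eqF. Qed.

Lemma trunc_exponent_le : trunc_exponent <= 2^-1.
Proof.
rewrite /trunc_exponent invfM ler_piMr ?invr_ge0 // invf_le1 ?exprn_gt0 //.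
by rewrite exprn_ege1 // lerDr ltW.
Qed.

Lemma trunc_exponent_mul_le : trunc_exponent * q <= 2^-1.
Proof.
have := rate_gt0; have := trunc_exponent_gt0; have := trunc_exponent_rate.
by rewrite mulrDr mulr1; lra.
Qed.

Section level.
Variable n : nat.
Hypothesis n_gt0 : (0 < n)%N.

Let nR_gt0 : 0 < n%:R :> R. Proof. by rewrite ltr0n. Qed.
Let nR_ge1 : 1 <= n%:R :> R. Proof. by rewrite ler1n. Qed.
Let powRnD (a b : R) : n%:R `^ (a + b) = n%:R `^ a * n%:R `^ b.
Proof. by rewrite powRD // (gt_eqF nR_gt0) implybT. Qed.

Definition trunc_level : R := n%:R `^ trunc_exponent.

Lemma trunc_level_ge1 : 1 <= trunc_level.
Proof.
rewrite -(powRr0 n%:R) ler_powR // ltW //; exact: trunc_exponent_gt0.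
Qed.

Lemma trunc_level_powR r : trunc_level `^ r = n%:R `^ (trunc_exponent * r).
Proof. by rewrite powRrM. Qed.

Lemma trunc_level_powR_le : trunc_level `^ q <= n%:R.
Proof.
rewrite trunc_level_powR -[leRHS]powRr1 ?ler0n // ler_powR //.
have := trunc_exponent_mul_le; lra.
Qed.

Lemma trunc_level_error_le :
  (1 + trunc_level `^ q) / Num.sqrt n%:R * trunc_level <= 2 * n%:R `^ (- rate).
Proof.
have J1 := trunc_level_ge1; have J0 : 0 < trunc_level by exact: lt_le_trans J1.
have Jq1 : 1 <= trunc_level `^ q by rewrite -(powRr0 trunc_level) ler_powR // ltW.
rewrite -trunc_exponent_rate powRnD -trunc_level_powR powRN powR12_sqrt ?(ltW nR_gt0) //.
rewrite mulrAC mulrA ler_wpM2r ?invr_ge0 ?sqrtr_ge0 //.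
rewrite powRD; last by rewrite (gt_eqF J0) implybT.
by rewrite powRr1 ?(ltW J0) // mulrC mulrCA ler_wpM2l ?(ltW J0) //; lra.
Qed.

Lemma trunc_level_div_le : trunc_level / n%:R <= n%:R `^ (- rate).
Proof.
rewrite /trunc_level -(@powR_inv1 _ n%:R) ?(ltW nR_gt0) // -powRnD ler_powR //.
rewrite -trunc_exponent_rate mulrDr mulr1.
have := trunc_exponent_le; have := mulr_gt0 trunc_exponent_gt0 q_gt0; lra.
Qed.

Lemma trunc_level_tail : trunc_level `^ (- (rate / trunc_exponent)) = n%:R `^ (- rate).
Proof.
by rewrite trunc_level_powR mulrN mulrC divfK // gt_eqF // trunc_exponent_gt0.
Qed.
End level.

Lemma cvg_prob_disconnected :
  (1 + expR (- (trunc_level n `^ q / 2))) ^+ n - 1 @[n --> \oo] --> (0 : R).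
Proof.
apply: cvg_exprn_onep => [n|]; first exact: expR_ge0.
have eta_q : 0 < trunc_exponent * q by rewrite mulr_gt0 // trunc_exponent_gt0.
pose p := 2 / (trunc_exponent * q); have p0 : 0 < p by rewrite divr_gt0.
apply: (@squeeze_cvgr _ _ _ _ (cst 0) (fun n => (2 * p) `^ p * n%:R `^ (- 1))).
- near=> n; have n0 : (0 < n)%N by near: n; exists 1%N.
  have n0R : 0 < n%:R :> R by rewrite ltr0n.
  rewrite mulr_ge0 ?expR_ge0 //= trunc_level_powR.
  have nx0 : 0 < n%:R `^ (trunc_exponent * q) :> R by rewrite powR_gt0.
  apply: le_trans (ler_wpM2l (ltW n0R) (expRN_half_le_powR p0 nx0)) _.
  rewrite -powRrM mulrN mulrC -mulrA ler_wpM2l ?powR_ge0 //.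
  rewrite [_ * p]mulrC divfK ?gt_eqF //.
  rewrite -[X in _ * X](powRr1 (ltW n0R)) -powRD; last by rewrite (gt_eqF n0R) implybT.
  by rewrite ler_powR ?ler1n //; lra.
- exact: cvg_cst.
- by rewrite -[X in _ --> X](mulr0 ((2 * p) `^ p)); apply: cvgMr; exact: powRN_cvgn.
Unshelve. all: by end_near. Qed.
End truncation_level.

Section mst_asymptotics.
Variables (R : realType) (q : R) (d : nat -> measure_display).
Variables (Omega : forall n, measurableType (d n)) (P : forall n, probability (Omega n) R).
Variable X : forall n, edge n -> {RV (P n) >-> R}.
Hypotheses (q_gt0 : 0 < q) (indepX : forall n, independent_RVs (@X n)).
Hypothesis lawX : forall n e, uniform_root_law q (@X n e).

Lemma rescaled_mst_weight_bigO_prob :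
  bigO_prob P (fun n w => `|rescaled_mst_weight q (@X n) w - mst_constant q|)
    (fun n _ => n%:R `^ (- rate q)).
Proof.
move=> eps eps0; have r0 : 0 < rate q / trunc_exponent q.
  by rewrite divr_gt0 ?rate_gt0 ?trunc_exponent_gt0.
have [C C0 tail] := integral_kappa_profile_tail q_gt0 r0.
have C12 : 0 < 12 / eps by rewrite divr_gt0.
exists (12 / eps + (1 + C)); first by rewrite addr_gt0 // ltr_wpDr.
near=> n; have n0 : (0 < n)%N by near: n; exists 1%N.
have rate_n0 : 0 < n%:R `^ (- rate q) by rewrite powR_gt0 // ltr0n.
have J0 : 0 < trunc_level q n := lt_le_trans ltr01 (trunc_level_ge1 q_gt0 n0).
rewrite onem_le_prob_sublevel; last first.
  apply: measurableT_comp => //; apply: measurable_funB => //.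
  exact: measurable_rescaled_mst_weight.
set D := n%:R `^ (- rate q) in rate_n0 *.
have threshold_le : 12 / eps * D + (trunc_level q n / n%:R + C * D) <=
    (12 / eps + (1 + C)) * D.
  by rewrite !mulrDl lerD2l lerD2r mul1r trunc_level_div_le.
have tailC := tail _ J0; rewrite trunc_level_tail // -/D in tailC.
apply: le_trans (mst_deviation_le q_gt0 n0 (@indepX n) (@lawX n) (ltW J0)
  (trunc_level_powR_le q_gt0 n0) tailC (mulr_gt0 C12 rate_n0) threshold_le) _.
rewrite lee_fin [leRHS]splitr; apply: lerD; last first.
  near: n; apply: (cvgr_le _ (cvg_prob_disconnected q_gt0)).
  by rewrite divr_gt0.
rewrite ler_pdivrMr ?mulr_gt0 ?invr_gt0 //.
have -> : eps / 2 * (12 / eps * D) = 3 * (2 * D) by field; rewrite gt_eqF.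
by rewrite -!mulrA ler_pM2l // mulrA trunc_level_error_le.
Unshelve. all: by end_near. Qed.

Lemma relative_mst_error n (w : Omega n) : (0 < n)%N ->
  let L := mst_constant q * n%:R `^ (1 - q^-1) in
  `|mst_weight (fun e => X e w) - L| / L =
  `|rescaled_mst_weight q (@X n) w - mst_constant q| / mst_constant q.
Proof.
move=> n0 L; have c0 := mst_constant_gt0 q_gt0.
have s0 : 0 < n%:R `^ (q^-1 - 1) :> R by rewrite powR_gt0 // ltr0n.
rewrite /L /rescaled_mst_weight -[1 - q^-1]opprB powRN; set s := _ `^ _ in s0 *.
set M := mst_weight _; set c := mst_constant q in c0 *.
have -> : s * M - c = s * (M - c / s) by field; rewrite gt_eqF.
by rewrite normrM (gtr0_norm s0); field; rewrite !gt_eqF.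
Qed.
End mst_asymptotics.

Theorem theorem2 (R : realType) (q : R) (q_gt0 : 0 < q) :
  exists2 c_q : R, 0 < c_q &
  forall (d : nat -> measure_display)
    (Omega : forall n : nat, measurableType (d n))
    (P : forall n : nat, probability (Omega n) R)
    (X : forall n : nat, edge n -> {RV (P n) >-> R}),
  (forall n : nat, independent_RVs (X n)) ->
  (forall (n : nat) (e : edge n), uniform_root_law q (X n e)) ->
  let L (n : nat) : R := c_q * n%:R `^ (1 - q^-1) in
  let M (n : nat) (w : Omega n) : R := mst_weight (fun e => X n e w) in
  let err (n : nat) (w : Omega n) : R := `|M n w - L n| / L n in
  bigO_prob P err (fun n _ => n%:R `^ (- (q / (2 * (q + 1))))) /\
  littleo_prob P err (fun _ _ => 1).
Proof.
have c_gt0 := mst_constant_gt0 q_gt0.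
exists (mst_constant q) => // d Omega P X indepX lawX L M err.
have errE n : (0 < n)%N -> err n =
    (fun w => `|rescaled_mst_weight q (X n) w - mst_constant q| / mst_constant q).
  by move=> n_gt0; apply/funext => w; exact: relative_mst_error.
have err_bigO : bigO_prob P err (fun n _ => n%:R `^ (- rate q)).
  move=> eps eps_gt0.
  have [C C_gt0 nearC] := rescaled_mst_weight_bigO_prob q_gt0 indepX lawX eps_gt0.
  exists (C / mst_constant q); first by rewrite divr_gt0.
  near=> n; have n_gt0 : (0 < n)%N by near: n; exists 1%N.
  rewrite errE //; under eq_set do rewrite ler_pdivrMr // mulrAC divfK ?gt_eqF //.
  by near: n.
split=> //; apply: bigO_prob_littleo err_bigO (powRN_cvgn (rate_gt0 q_gt0)).
  near=> n; have n_gt0 : (0 < n)%N by near: n; exists 1%N.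
  rewrite errE //; apply: measurable_funM => //; apply: measurableT_comp => //.
  by apply: measurable_funB => //; exact: measurable_rescaled_mst_weight.
by move=> n w; rewrite divr_ge0 // mulr_ge0 ?powR_ge0 // ltW.
Unshelve. all: by end_near. Qed.
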